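(* Timeline Partial Vertex Cover can be solved in $\big((k+1)(\ell+2)\big)^{2\cdot \mathrm{vimw}}\cdot (n+T)^{\mathcal{O}(1)}$ time, where $n=|V|$ and $\mathrm{vimw}$ is the vertex-interval-membership-width of the input temporal graph.
   Context: A temporal graph $\mathcal{G}=(G_1,\dots,G_T)$ is a finite sequence of simple undirected graphs (snapshots) on a common finite vertex set $V$, $n=|V|$. A temporal edge is a pair $(e,i)$ with $e\in E(G_i)$. An activity interval is a triple $(v,a,b)$ with $v\in V$, $1\le a\le b\le T$; its length is $b-a$. A $k$-activity $\ell$-timeline is a set of activity intervals with at most $k$ intervals per vertex, each of length at most $\ell$. A vertex $v$ is active at time $i$ if some $(v,a,b)$ in the timeline has $a\le i\le b$; the timeline covers $(uv,i)$ if $u$ or $v$ is active at time $i$. Timeline Partial Vertex Cover: given $\mathcal{G}$ and integers $k\ge1,\ell\ge0,t\ge0$, decide whether some $k$-activity $\ell$-timeline covers at least $t$ temporal edges. The vertex-interval-membership sequence of $\mathcal{G}$ is $(F_i)_{i\in[T]}$ with $F_i=\{v\in V:\exists p\le i\le q \text{ with } \deg_{G_p}(v)\ge1,\ \deg_{G_q}(v)\ge1\}$; $\mathrm{vimw}(\mathcal{G})=\max_i|F_i|$. *)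

(* Defs.v *)
From mathcomp Require Import all_boot.

Set Implicit Arguments.
Unset Strict Implicit.
Unset Printing Implicit Defensive.

(** * Temporal graphs and timelines *)

(* Times 1, ..., T are represented by 'I_T (shifted by one); an edge is a
   two-element set of vertices. *)
Record tgraph (V : finType) (T : nat) := TGraph {
  edges : 'I_T -> {set {set V}};
  edges_card2 : forall (i : 'I_T) (e : {set V}), e \in edges i -> #|e| = 2
}.

Section Timeline.
Variables (V : finType) (T : nat).
Implicit Types (G : tgraph V T) (S : {set V * 'I_T * 'I_T}).

Definition temporal_edges G : {set {set V} * 'I_T} :=
  [set x | x.1 \in edges G x.2].

Definition deg G (i : 'I_T) (v : V) : nat := #|[set e in edges G i | v \in e]|.

(* The triple ((v, a), b) stands for the activity interval (v, a, b). *)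
Definition is_timeline (k l : nat) S : bool :=
  [forall x in S, (x.1.2 <= x.2) && (x.2 - x.1.2 <= l)]
  && [forall v : V, #|[set x in S | x.1.1 == v]| <= k].

Definition active S (v : V) (i : 'I_T) : bool :=
  [exists x in S, (x.1.1 == v) && (x.1.2 <= i <= x.2)].

Definition covered G S : {set {set V} * 'I_T} :=
  [set x in temporal_edges G | [exists v in x.1, active S v x.2]].

Definition timeline_partial_vertex_cover G (k l t : nat) : bool :=
  [exists S, is_timeline k l S && (t <= #|covered G S|)].

Definition vim_bag G (i : 'I_T) : {set V} :=
  [set v | [exists p : 'I_T, exists q : 'I_T,
    [&& p <= i, i <= q, 1 <= deg G p v & 1 <= deg G q v]]].

Definition vimw G : nat := \max_(i < T) #|vim_bag G i|.

(* The numbers n, T, k, l, t, followed by the T adjacency matrices in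
   row-major order; one number per memory cell. *)
Definition encode G (k l t : nat) : seq nat :=
  [:: #|V|; T; k; l; t] ++
  flatten [seq [seq nat_of_bool ([set u; v] \in edges G i)
                 | u <- enum V, v <- enum V] | i <- enum 'I_T].

End Timeline.

(** * Random access machine *)

(* A unit-cost RAM over the natural numbers, with structured control flow.
   As in the Cook-Reckhow RAM, the only arithmetic is addition and (truncated)
   subtraction: a unit-cost multiplication would let numbers of exponential
   bit-length be built in polynomially many steps.  Registers are addressed
   only statically, so that a program uses finitely many of them; the memory
   is addressed indirectly. *)

Record state := State { reg : nat -> nat; mem : nat -> nat }.

Inductive cmd :=
| Const of nat & nat         (* Const r c   : r := c        *)
| Add of nat & nat & nat     (* Add r a b   : r := a + b    *)
| Sub of nat & nat & nat     (* Sub r a b   : r := a - b    *)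
| Read of nat & nat          (* Read r a    : r := mem[a]   *)
| Write of nat & nat         (* Write a b   : mem[a] := b   *)
| Seq of cmd & cmd
| IfLt of nat & nat & cmd & cmd
| WhileLt of nat & nat & cmd.

Definition upd (f : nat -> nat) (x y : nat) : nat -> nat :=
  fun z => if z == x then y else f z.

Definition set_reg (s : state) (r x : nat) : state :=
  State (upd (reg s) r x) (mem s).

Definition set_mem (s : state) (a x : nat) : state :=
  State (reg s) (upd (mem s) a x).

(* exec p s tau s' : started in s, p halts in s' after exactly tau steps,
   each assignment and each test being one step. *)
Inductive exec : cmd -> state -> nat -> state -> Prop :=
| ExecConst r c s : exec (Const r c) s 1 (set_reg s r c)
| ExecAdd r a b s : exec (Add r a b) s 1 (set_reg s r (reg s a + reg s b))
| ExecSub r a b s : exec (Sub r a b) s 1 (set_reg s r (reg s a - reg s b))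
| ExecRead r a s : exec (Read r a) s 1 (set_reg s r (mem s (reg s a)))
| ExecWrite a b s : exec (Write a b) s 1 (set_mem s (reg s a) (reg s b))
| ExecSeq p q s1 s2 s3 tau1 tau2 :
    exec p s1 tau1 s2 -> exec q s2 tau2 s3 ->
    exec (Seq p q) s1 (tau1 + tau2) s3
| ExecIfTrue a b p q s s' tau :
    reg s a < reg s b -> exec p s tau s' -> exec (IfLt a b p q) s tau.+1 s'
| ExecIfFalse a b p q s s' tau :
    reg s b <= reg s a -> exec q s tau s' -> exec (IfLt a b p q) s tau.+1 s'
| ExecWhileTrue a b p s1 s2 s3 tau1 tau2 :
    reg s1 a < reg s1 b -> exec p s1 tau1 s2 ->
    exec (WhileLt a b p) s2 tau2 s3 ->
    exec (WhileLt a b p) s1 (tau1 + tau2).+1 s3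
| ExecWhileFalse a b p s :
    reg s b <= reg s a -> exec (WhileLt a b p) s 1 s.

Definition init_state (input : seq nat) : state :=
  State (fun=> 0) (nth 0 input).

Definition output (s : state) : nat := reg s 0.

Definition decides_in_time (p : cmd) (input : seq nat) (answer : bool)
    (bound : nat) : Prop :=
  exists (tau : nat) (s : state),
    [/\ exec p (init_state input) tau s, tau <= bound
      & output s = nat_of_bool answer].

(* Main.v *)
From mathcomp Require Import all_boot zify.
Require Import Defs.

Set Implicit Arguments.
Unset Strict Implicit.
Unset Printing Implicit Defensive.

(** Intervals may be assumed to have length exactly [l] (cut off at the end of
    time), and no interval of [v] need start before the first time at which [v]
    has an edge.  The relevant history of [v] at a time is then the number of
    intervals started so far together with the remaining duration of the last
    one, at most [(k + 1) * (l + 2)] possibilities, and it matters only while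
    [v] is in the bag.  A table indexed by the states of the bag vertices, with
    the maximal number of edges covered so far, is computed time step by time
    step; testing all pairs of consecutive states gives the exponent
    [2 * vimw].  Both [k] and [l] are first replaced by their minimum with [T],
    so that the number of states of one vertex is polynomial in [T] and numbers
    can be multiplied and divided by repeated addition and subtraction.

    A table entry is the value of a pure expression with bounded loops reading
    the memory.  Such expressions are compiled to the machine once and for all,
    with a time bound that is polynomial in the values of the registers bounding
    the loops. *)

(** * Compiling expressions *)

(** A loop bound is a register rather than an expression, so that running times follow from bounds
    on a few registers alone. *)
Inductive expr :=
| Num of nat
| Var of nat
| EAdd of expr & expr
| ESub of expr & expr
| ELoad of expr
| If of expr & expr & expr & expr
| Let of nat & expr & expr
| Fold of nat & nat & nat & expr & expr.

Fixpoint ev (m : nat -> nat) (e : expr) (env : nat -> nat) : nat :=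
  match e with
  | Num c => c
  | Var x => env x
  | EAdd e1 e2 => ev m e1 env + ev m e2 env
  | ESub e1 e2 => ev m e1 env - ev m e2 env
  | ELoad e1 => m (ev m e1 env)
  | If e1 e2 e3 e4 =>
      if ev m e1 env < ev m e2 env then ev m e3 env else ev m e4 env
  | Let x e1 e2 => ev m e2 (upd env x (ev m e1 env))
  | Fold x a r e0 e1 =>
      iteri (env r) (fun i acc => ev m e1 (upd (upd env x i) a acc))
            (ev m e0 env)
  end.

Definition tmp := 80.

Definition move x y := Seq (Const x 0) (Add x x y).

(** The registers from [d] on serve as an evaluation stack, with the result in [d]. A loop keeps its
    accumulator in [a] between rounds, which leaves [d] free for the body. *)
Fixpoint compile (e : expr) (d : nat) : cmd :=
  match e with
  | Num c => Const d c
  | Var x => move d x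
  | EAdd e1 e2 => Seq (compile e1 d) (Seq (compile e2 d.+1) (Add d d d.+1))
  | ESub e1 e2 => Seq (compile e1 d) (Seq (compile e2 d.+1) (Sub d d d.+1))
  | ELoad e1 => Seq (compile e1 d) (Read d d)
  | If e1 e2 e3 e4 =>
      Seq (compile e1 d) (Seq (compile e2 d.+1)
        (IfLt d d.+1 (compile e3 d) (compile e4 d)))
  | Let x e1 e2 => Seq (compile e1 d) (Seq (move x d) (compile e2 d))
  | Fold x a r e0 e1 =>
      Seq (compile e0 d) (Seq (move a d) (Seq (Const x 0) (Seq
        (WhileLt x r
           (Seq (compile e1 d) (Seq (move a d) (Seq (Const d 1) (Add x x d)))))
        (move d a))))
  end.

(** Both branches of an [If] are charged, so the bound depends on the state only through the bounds
    [B] on the loop registers. *)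
Fixpoint tm (B : nat -> nat) (e : expr) : nat :=
  match e with
  | Num _ => 1
  | Var _ => 2
  | EAdd e1 e2 | ESub e1 e2 => tm B e1 + tm B e2 + 1
  | ELoad e1 => tm B e1 + 1
  | If e1 e2 e3 e4 => tm B e1 + tm B e2 + tm B e3 + tm B e4 + 1
  | Let _ e1 e2 => tm B e1 + tm B e2 + 2
  | Fold _ _ r e0 e1 => tm B e0 + 6 + B r * (tm B e1 + 5)
  end.

(* [R] lists the registers that may bound a loop, [A] the registers that must
   survive the evaluation: a binder may only overwrite registers outside [A]. *)
Fixpoint wf (R A : seq nat) (e : expr) : bool :=
  match e with
  | Num _ => true
  | Var x => x \in A
  | EAdd e1 e2 | ESub e1 e2 => wf R A e1 && wf R A e2
  | ELoad e1 => wf R A e1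
  | If e1 e2 e3 e4 => [&& wf R A e1, wf R A e2, wf R A e3 & wf R A e4]
  | Let x e1 e2 => [&& x \notin A, x < tmp, wf R A e1 & wf R (x :: A) e2]
  | Fold x a r e0 e1 =>
      [&& x \notin A, a \notin A, x != a, x < tmp & a < tmp] &&
      [&& r \in R, r \in A, wf R A e0 & wf R [:: x, a & A] e1]
  end.

Lemma eq_iteri_lt (X : Type) n (f g : nat -> X -> X) x :
  (forall i y, i < n -> f i y = g i y) -> iteri n f x = iteri n g x.
Proof.
elim: n => // n IH fg /=; rewrite IH ?fg // => i y ltin.
exact/fg/ltnW.
Qed.

(** Compiled code overwrites bound registers. Later operands keep their values because they read
    only registers in [A] and those they bind themselves. *)
Lemma ev_agree m R A e env env' :
  wf R A e -> {in A, env =1 env'} -> ev m e env = ev m e env'.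
Proof.
elim: e A env env' => //=.
- by move=> x A env env' xA ag; apply: ag.
- move=> e1 IH1 e2 IH2 A env env' /andP[w1 w2] ag.
  by rewrite (IH1 _ _ _ w1 ag) (IH2 _ _ _ w2 ag).
- move=> e1 IH1 e2 IH2 A env env' /andP[w1 w2] ag.
  by rewrite (IH1 _ _ _ w1 ag) (IH2 _ _ _ w2 ag).
- by move=> e1 IH1 A env env' w1 ag; rewrite (IH1 _ _ _ w1 ag).
- move=> e1 IH1 e2 IH2 e3 IH3 e4 IH4 A env env' /and4P[w1 w2 w3 w4] ag.
  by rewrite (IH1 _ _ _ w1 ag) (IH2 _ _ _ w2 ag) (IH3 _ _ _ w3 ag)
             (IH4 _ _ _ w4 ag).
- move=> x e1 IH1 e2 IH2 A env env' /and4P[xA _ w1 w2] ag.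
  rewrite (IH1 _ _ _ w1 ag); apply: IH2 w2 _ => y; rewrite inE /upd.
  by case: eqP => //= _; apply: ag.
- move=> x a r e0 IH0 e1 IH1 A env env' /andP[_ /and4P[_ rA w0 w1]] ag.
  rewrite (IH0 _ _ _ w0 ag) (ag _ rA); apply: eq_iteri_lt => i y _.
  apply: IH1 w1 _ => z; rewrite !inE /upd.
  by case: (z == a) => //; case: (z == x) => //=; apply: ag.
Qed.

(** * Execution rules with step counts *)

Definition runs p s (Q : nat -> state -> Prop) : Prop :=
  exists tau s', exec p s tau s' /\ Q tau s'.

Lemma runs_weaken p s (Q Q' : nat -> state -> Prop) :
  runs p s Q -> (forall tau s', Q tau s' -> Q' tau s') -> runs p s Q'.
Proof. by move=> [tau [s' [? q]]] QQ; exists tau, s'; split=> //; apply: QQ. Qed.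

Lemma runs_seq p q s Q :
  runs p s (fun t1 s1 => runs q s1 (fun t2 s2 => Q (t1 + t2) s2)) ->
  runs (Seq p q) s Q.
Proof.
move=> [t1 [s1 [e1 [t2 [s2 [e2 q2]]]]]]; exists (t1 + t2), s2; split=> //.
exact: ExecSeq e1 e2.
Qed.

Lemma runs_const r c s Q : Q 1 (set_reg s r c) -> runs (Const r c) s Q.
Proof. by move=> q; exists 1, (set_reg s r c); split=> //; constructor. Qed.

Lemma runs_add r a b s Q :
  Q 1 (set_reg s r (reg s a + reg s b)) -> runs (Add r a b) s Q.
Proof. by move=> q; eexists; eexists; split; [constructor|]. Qed.

Lemma runs_sub r a b s Q :
  Q 1 (set_reg s r (reg s a - reg s b)) -> runs (Sub r a b) s Q.
Proof. by move=> q; eexists; eexists; split; [constructor|]. Qed.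

Lemma runs_read r a s Q :
  Q 1 (set_reg s r (mem s (reg s a))) -> runs (Read r a) s Q.
Proof. by move=> q; eexists; eexists; split; [constructor|]. Qed.

Lemma runs_write a b s Q :
  Q 1 (set_mem s (reg s a) (reg s b)) -> runs (Write a b) s Q.
Proof. by move=> q; eexists; eexists; split; [constructor|]. Qed.

Lemma runs_if a b p q s Q :
  (if reg s a < reg s b then runs p s (fun tau => Q tau.+1)
   else runs q s (fun tau => Q tau.+1)) ->
  runs (IfLt a b p q) s Q.
Proof.
case: ltnP => lab [tau [s' [e' q']]]; exists tau.+1, s'; split=> //.
- exact: ExecIfTrue.
- exact: ExecIfFalse.
Qed.

Lemma runs_move x y s Q :
  x != y ->
  (forall s', mem s' = mem s -> reg s' =1 upd (reg s) x (reg s y) -> Q 2 s') ->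
  runs (move x y) s Q.
Proof.
move=> xy H; apply/runs_seq/runs_const/runs_add; apply: H => //= z.
by rewrite /upd eqxx [y == x]eq_sym (negPf xy) add0n; case: eqP.
Qed.

(* The invariant is indexed by the number of iterations done so far. *)
Lemma runs_while a b p s N c (I : nat -> state -> Prop) :
  I 0 s ->
  (forall i s', i < N -> I i s' -> reg s' a < reg s' b /\
     runs p s' (fun tau s'' => tau <= c /\ I i.+1 s'')) ->
  (forall s', I N s' -> reg s' b <= reg s' a) ->
  runs (WhileLt a b p) s (fun tau s' => tau <= N * c.+1 + 1 /\ I N s').
Proof.
move=> I0 IS IN.
suff: forall k i s', i + k = N -> I i s' ->
    runs (WhileLt a b p) s' (fun tau s'' => tau <= k * c.+1 + 1 /\ I N s'').
  by move=> /(_ N 0 s (add0n N) I0).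
elim=> [|k IH] i s' Ei Ii.
  exists 1, s'; split; first by constructor; apply: IN; rewrite -Ei addn0.
  by rewrite -Ei addn0.
have [|lab [t1 [s1 [e1 [le1 I1]]]]] := IS i s' _ Ii.
  by rewrite -Ei addnS ltnS leq_addr.
have [|t2 [s2 [e2 [le2 I2]]]] := IH i.+1 s1 _ I1; first by rewrite addSnnS.
exists (t1 + t2).+1, s2; split; first exact: ExecWhileTrue e1 e2.
by split=> //; rewrite mulSn -addnA addSn ltnS leq_add.
Qed.

(** Induction on [e]. The clause [tmp <= y < d] of the frame condition protects a first operand,
    kept in [d], while the second is evaluated into [d.+1]. *)
Lemma compile_runs B R A e d s :
  {subset R <= A} -> (forall y, y \in A -> y < tmp) ->
  (forall r, r \in R -> reg s r <= B r) ->
  wf R A e -> tmp <= d ->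
  runs (compile e d) s (fun tau s' =>
    [/\ tau <= tm B e, mem s' = mem s, reg s' d = ev (mem s) e (reg s)
      & forall y, (y \in A) || (tmp <= y < d) -> reg s' y = reg s y]).
Proof.
have neq y d' : y < tmp -> tmp <= d' -> (y == d') = false.
  by move=> ylt dge; apply: ltn_eqF; apply: leq_trans dge.
have ltneq y d' : y < d' -> (y == d') = false by move=> /ltn_eqF.
elim: e A d s => /=.
- move=> c A d s RA At Bs _ dt; apply: runs_const; split=> //=.
    by rewrite /upd eqxx.
  move=> y yA; rewrite /upd; case: eqP yA => // ->.
  by rewrite ltnn andbF orbF => /At; rewrite ltnNge dt.
- move=> x A d s RA At Bs xA dt; apply: runs_move.
    by rewrite eq_sym neq // At.
  move=> s' ms' rs'; split=> //; first by rewrite rs' /upd eqxx.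
  move=> y yA; rewrite rs' /upd; case: eqP yA => // ->.
  by rewrite ltnn andbF orbF => /At; rewrite ltnNge dt.
- move=> e1 IH1 e2 IH2 A d s RA At Bs /andP[w1 w2] dt; apply: runs_seq.
  apply: runs_weaken (IH1 A d s RA At Bs w1 dt) _ => t1 s1 [le1 m1 r1 f1].
  apply: runs_seq.
  have Bs1 r : r \in R -> reg s1 r <= B r.
    by move=> rR; rewrite f1 ?RA ?Bs.
  apply: runs_weaken (IH2 A d.+1 s1 RA At Bs1 w2 (leqW dt)) _.
  move=> t2 s2 [le2 m2 r2 f2]; apply: runs_add; split=> /=.
  + by rewrite addnA leq_add // leq_add.
  + by rewrite m2 m1.
  + rewrite /upd eqxx r2 f2 ?dt ?ltnSn ?orbT // r1 m1; congr (_ + _).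
    by apply: ev_agree w2 _ => y yA; rewrite f1 ?yA.
  + move=> y yA; rewrite /upd; case: eqP => [yd|_].
      by move: yA; rewrite yd ltnn andbF orbF => /At; rewrite ltnNge dt.
    rewrite f2 ?f1 //; case/orP: yA => [->//|/andP[-> ylt]].
    by rewrite ltnW ?orbT.
- move=> e1 IH1 e2 IH2 A d s RA At Bs /andP[w1 w2] dt; apply: runs_seq.
  apply: runs_weaken (IH1 A d s RA At Bs w1 dt) _ => t1 s1 [le1 m1 r1 f1].
  apply: runs_seq.
  have Bs1 r : r \in R -> reg s1 r <= B r.
    by move=> rR; rewrite f1 ?RA ?Bs.
  apply: runs_weaken (IH2 A d.+1 s1 RA At Bs1 w2 (leqW dt)) _.
  move=> t2 s2 [le2 m2 r2 f2]; apply: runs_sub; split=> /=.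
  + by rewrite addnA leq_add // leq_add.
  + by rewrite m2 m1.
  + rewrite /upd eqxx r2 f2 ?dt ?ltnSn ?orbT // r1 m1; congr (_ - _).
    by apply: ev_agree w2 _ => y yA; rewrite f1 ?yA.
  + move=> y yA; rewrite /upd; case: eqP => [yd|_].
      by move: yA; rewrite yd ltnn andbF orbF => /At; rewrite ltnNge dt.
    rewrite f2 ?f1 //; case/orP: yA => [->//|/andP[-> ylt]].
    by rewrite ltnW ?orbT.
- move=> e1 IH1 A d s RA At Bs w1 dt; apply: runs_seq.
  apply: runs_weaken (IH1 A d s RA At Bs w1 dt) _ => t1 s1 [le1 m1 r1 f1].
  apply: runs_read; split=> //=; first by rewrite leq_add2r.
    by rewrite /upd eqxx m1 r1.
  move=> y yA; rewrite /upd; case: eqP => [yd|_]; last exact: f1.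
  by move: yA; rewrite yd ltnn andbF orbF => /At; rewrite ltnNge dt.
- move=> e1 IH1 e2 IH2 e3 IH3 e4 IH4 A d s RA At Bs /and4P[w1 w2 w3 w4] dt.
  apply: runs_seq.
  apply: runs_weaken (IH1 A d s RA At Bs w1 dt) _ => t1 s1 [le1 m1 r1 f1].
  apply: runs_seq.
  have Bs1 r : r \in R -> reg s1 r <= B r.
    by move=> rR; rewrite f1 ?RA ?Bs.
  apply: runs_weaken (IH2 A d.+1 s1 RA At Bs1 w2 (leqW dt)) _.
  move=> t2 s2 [le2 m2 r2 f2].
  have f12 y : (y \in A) || (tmp <= y < d) -> reg s2 y = reg s y.
    move=> yA; rewrite f2 ?f1 //; case/orP: yA => [->//|/andP[-> ylt]].
    by rewrite ltnW ?orbT.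
  have Bs2 r : r \in R -> reg s2 r <= B r.
    by move=> rR; rewrite f12 ?RA ?Bs.
  have ag2 : {in A, reg s2 =1 reg s} by move=> y yA; rewrite f12 ?yA.
  apply: runs_if; rewrite r2 f2 ?dt ?ltnSn ?orbT // r1 m1.
  rewrite (ev_agree _ w2 (env' := reg s)); last by move=> y yA; rewrite f1 ?yA.
  case: ifP => cnd.
  + apply: runs_weaken (IH3 A d s2 RA At Bs2 w3 dt) _ => t3 s3 [le3 m3 r3 f3].
    split; last by move=> y yA; rewrite f3 ?f12.
    * rewrite addn1 !addnS ltnS addnA (leq_trans (leq_add (leq_add le1 le2) le3)) //.
      exact: leq_addr.
    * by rewrite m3 m2 m1.
    * by rewrite r3 m2 m1 (ev_agree _ w3 ag2) cnd.
  + apply: runs_weaken (IH4 A d s2 RA At Bs2 w4 dt) _ => t3 s3 [le3 m3 r3 f3].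
    split; last by move=> y yA; rewrite f3 ?f12.
    * rewrite addn1 !addnS ltnS addnA (leq_trans (leq_add (leq_add le1 le2) le3)) //.
      by rewrite leq_add2r leq_addr.
    * by rewrite m3 m2 m1.
    * by rewrite r3 m2 m1 (ev_agree _ w4 ag2) cnd.
- move=> x e1 IH1 e2 IH2 A d s RA At Bs /and4P[xA xt w1 w2] dt.
  apply: runs_seq.
  apply: runs_weaken (IH1 A d s RA At Bs w1 dt) _ => t1 s1 [le1 m1 r1 f1].
  apply/runs_seq/runs_move; first by rewrite neq.
  move=> s2 m2 r2.
  have RxA : {subset R <= x :: A} by move=> y /RA yA; rewrite inE yA orbT.
  have xAt y : y \in x :: A -> y < tmp by rewrite inE => /orP[/eqP->//|/At].
  have f12 y : (y \in A) || (tmp <= y < d) -> reg s2 y = reg s y.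
    move=> yA; rewrite r2 /upd; case: eqP => [yx|_]; last exact: f1.
    by move: yA; rewrite yx (negPf xA) /= leqNgt xt.
  have Bs2 r : r \in R -> reg s2 r <= B r.
    by move=> rR; rewrite f12 ?RA ?Bs.
  apply: runs_weaken (IH2 _ d s2 RxA xAt Bs2 w2 dt) _ => t3 s3 [le3 m3 r3 f3].
  split.
  + by rewrite [2 + _]addnC addnA leq_add2r leq_add.
  + by rewrite m3 m2.
  + rewrite r3 m2 m1; apply: ev_agree w2 _ => y; rewrite inE r2 /upd r1.
    by case: eqP => //= _ yA; rewrite f1 ?yA.
  + by move=> y yA; rewrite f3 ?f12 // inE -orbA yA orbT.
- move=> x a r e0 IH0 e1 IH1 A d s RA At Bs.
  case/andP=> /and5P[xA aA xa xt at_] /and4P[rR rA w0 w1] dt.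
  apply: runs_seq.
  apply: runs_weaken (IH0 A d s RA At Bs w0 dt) _ => t1 s1 [le1 m1 r1 f1].
  apply/runs_seq/runs_move; first by rewrite neq.
  move=> s2 m2 r2; apply/runs_seq/runs_const; apply: runs_seq.
  pose keep y := (y \in A) || (tmp <= y < d).
  have keepx y : keep y -> (y == x) = false.
    by rewrite /keep; case: eqP => // ->; rewrite (negPf xA) /= leqNgt xt.
  have keepa y : keep y -> (y == a) = false.
    by rewrite /keep; case: eqP => // ->; rewrite (negPf aA) /= leqNgt at_.
  have keepd y : keep y -> (y == d) = false.
    rewrite /keep; case: eqP => // ->; rewrite ltnn andbF orbF => /At.
    by rewrite ltnNge dt.
  pose f i acc := ev (mem s) e1 (upd (upd (reg s) x i) a acc).
  (* The invariant leaves out [d], which every round overwrites, and the registers bound inside the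
     body. *)
  pose Inv i s' := [/\ mem s' = mem s, reg s' x = i,
    reg s' a = iteri i f (ev (mem s) e0 (reg s))
    & forall y, keep y -> reg s' y = reg s y].
  have xd : (x == d) = false by apply: neq.
  have ad : (a == d) = false by apply: neq.
  apply: (@runs_weaken _ _ (fun tau s' => tau <= reg s r * (tm B e1 + 4).+1 + 1
    /\ Inv (reg s r) s')); first apply: runs_while.
  + split=> /=; rewrite ?m2 // /upd ?eqxx //.
    * by rewrite [a == x]eq_sym (negPf xa) r2 /upd eqxx r1.
    * by move=> y ky; rewrite keepx // r2 /upd keepa // f1.
  + move=> i s' ltir [m' x' a' f']; split; first by rewrite x' f' // /keep rA.
    have RxA : {subset R <= [:: x, a & A]}.
      by move=> y /RA yA; rewrite !inE yA !orbT.
    have xAt y : y \in [:: x, a & A] -> y < tmp.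
      by rewrite !inE => /or3P[/eqP->//|/eqP->//|/At].
    have Bs' q : q \in R -> reg s' q <= B q.
      by move=> qR; rewrite f' ?Bs // /keep RA.
    apply: runs_seq.
    apply: runs_weaken (IH1 _ d s' RxA xAt Bs' w1 dt) _ => t3 s3 [le3 m3 r3 f3].
    apply/runs_seq/runs_move; first by rewrite neq.
    move=> s4 m4 r4; apply/runs_seq/runs_const/runs_add.
    split; first by rewrite !addnA addn2 !addnS !addn0 !ltnS.
    split=> /=; rewrite ?m4 ?m3 // /upd.
    * rewrite eqxx eqxx xd r4 /upd (negPf xa) f3 ?inE ?eqxx // x' addn1 //.
    * rewrite [a == x]eq_sym (negPf xa) ad r4 /upd eqxx r3 m' /f.
      apply: ev_agree w1 _ => y; rewrite !inE /upd.
      case: (y =P a) => [->|_]; first by rewrite a'.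
      case: (y =P x) => [->|_]; first by rewrite x'.
      by move=> /= yA; rewrite f' // /keep yA.
    * move=> y ky; rewrite keepx // keepd // r4 /upd keepa // f3.
        exact: f'.
      by rewrite !inE; case/orP: ky => ->; rewrite ?orbT.
  + by move=> s' [_ -> _ f']; rewrite f' // /keep rA.
  move=> t3 s3 [le3 [m3 x3 a3 f3]]; apply: runs_move; first by rewrite eq_sym ad.
  move=> s4 m4 r4; split.
  + have -> : tm B e0 + 6 + B r * (tm B e1 + 5) =
       tm B e0 + (2 + (1 + (B r * (tm B e1 + 4).+1 + 1 + 2))) by lia.
    rewrite leq_add // !leq_add2l leq_add2r (leq_trans le3) // leq_add2r.
    by rewrite leq_mul2r Bs ?orbT.
  + by rewrite m4.
  + by rewrite r4 /upd eqxx a3.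
  + by move=> y ky; rewrite r4 /upd keepd ?f3.
Qed.

(** * Blocks of register assignments *)

Fixpoint block (l : seq (nat * expr)) : cmd :=
  if l is (x, e) :: l' then
    Seq (compile e tmp) (Seq (move x tmp) (block l'))
  else Const tmp 0.

Fixpoint bev (m : nat -> nat) (l : seq (nat * expr)) (env : nat -> nat) :=
  if l is (x, e) :: l' then bev m l' (upd env x (ev m e env)) else env.

Fixpoint btm (B : nat -> nat) (l : seq (nat * expr)) : nat :=
  if l is (x, e) :: l' then tm B e + 2 + btm B l' else 1.

(** The time bound of each expression needs the loop registers below their bounds at that point of
    the block, hence a condition at every assignment to a register of [R]. *)
Fixpoint bbound (R : seq nat) (B m : nat -> nat) (l : seq (nat * expr))
    (env : nat -> nat) : Prop :=
  if l is (x, e) :: l' then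
    (x \in R -> ev m e env <= B x) /\ bbound R B m l' (upd env x (ev m e env))
  else True.

Lemma bev_notin m l env x :
  x \notin [seq p.1 | p <- l] -> bev m l env x = env x.
Proof.
elim: l env => //= -[y e] l IH env; rewrite inE negb_or => /andP[xy xl].
by rewrite IH // /upd (negPf xy).
Qed.

Lemma block_runs B R A l s env :
  {subset R <= A} -> (forall y, y \in A -> y < tmp) ->
  (forall r, r \in R -> env r <= B r) ->
  all (fun p => (p.1 \in A) && wf R A p.2) l ->
  {in A, reg s =1 env} -> bbound R B (mem s) l env ->
  runs (block l) s (fun tau s' =>
    [/\ tau <= btm B l, mem s' = mem s
      & {in A, reg s' =1 bev (mem s) l env}]).
Proof.
move=> RA At; elim: l s env => [|[x e] l IH] s env Bs /=.
  move=> _ ag _; apply: runs_const; split=> // y yA /=.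
  by rewrite /upd ltn_eqF ?ag // At.
case/andP=> /andP[xA we] wl ag [bx bl].
have Bs0 r : r \in R -> reg s r <= B r by move=> rR; rewrite ag ?RA ?Bs.
apply: runs_seq.
apply: runs_weaken (compile_runs RA At Bs0 we (leqnn _)) _.
move=> t1 s1 [le1 m1 r1 f1]; apply/runs_seq/runs_move.
  by rewrite ltn_eqF ?At.
move=> s2 m2 r2.
have -> : mem s = mem s2 by rewrite m2.
apply: runs_weaken (IH s2 (upd env x (ev (mem s2) e env)) _ wl _ _) _.
- move=> r rR; rewrite /upd; case: eqP => [rx|_]; last exact: Bs.
  by rewrite rx m2 m1 bx // -rx.
- move=> y yA; rewrite r2 /upd; case: eqP => _.
    by rewrite r1 m2 m1; apply: ev_agree we _.
  by rewrite f1 ?yA // ag.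
- by rewrite m2 m1.
move=> t3 s3 [le3 m3 r3]; split=> //.
by rewrite addnA leq_add // leq_add2r.
Qed.

(** * Polynomial bounds on evaluation time *)

Fixpoint fdep (e : expr) : nat :=
  match e with
  | Num _ | Var _ => 0
  | EAdd e1 e2 | ESub e1 e2 | Let _ e1 e2 => maxn (fdep e1) (fdep e2)
  | ELoad e1 => fdep e1
  | If e1 e2 e3 e4 => maxn (maxn (fdep e1) (fdep e2)) (maxn (fdep e3) (fdep e4))
  | Fold _ _ _ e0 e1 => maxn (fdep e0) (fdep e1).+1
  end.

(** Setting all loop bounds to 1 yields the coefficient. Each level of loop nesting contributes at
    most one factor [X], so the nesting depth is the degree. *)
Lemma tm_poly B R A e X : wf R A e -> {in R, forall r, B r <= X} -> 0 < X ->
  tm B e <= tm (fun=> 1) e * X ^ fdep e.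
Proof.
move=> + BX X0; have pow i j : i <= j -> X ^ i <= X ^ j by apply: leq_pexp2l.
have lift c i j t : t <= c * X ^ i -> i <= j -> t <= c * X ^ j.
  by move=> le ij; rewrite (leq_trans le) // leq_mul2l pow ?orbT.
have one c j : c <= c * X ^ j by rewrite leq_pmulr // expn_gt0 X0.
have maxr i j : j <= maxn i j by rewrite leq_max leqnn orbT.
have maxl i j : i <= maxn i j by rewrite leq_max leqnn.
elim: e A => //=.
- move=> e1 IH1 e2 IH2 A /andP[/IH1 w1 /IH2 w2].
  rewrite !mulnDl; apply: leq_add (one 1 _).
  by rewrite leq_add ?(lift _ _ _ _ w1) ?(lift _ _ _ _ w2).
- move=> e1 IH1 e2 IH2 A /andP[/IH1 w1 /IH2 w2].
  rewrite !mulnDl; apply: leq_add (one 1 _).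
  by rewrite leq_add ?(lift _ _ _ _ w1) ?(lift _ _ _ _ w2).
- by move=> e1 IH1 A /IH1 w1; rewrite mulnDl; apply: leq_add (one 1 _).
- move=> e1 IH1 e2 IH2 e3 IH3 e4 IH4 A /and4P[/IH1 w1 /IH2 w2 /IH3 w3 /IH4 w4].
  rewrite !mulnDl; apply: leq_add (one 1 _).
  rewrite !leq_add //; apply: lift; (try by eassumption);
  by rewrite !leq_max leqnn ?orbT.
- move=> x e1 IH1 e2 IH2 A /and4P[_ _ /IH1 w1 /IH2 w2].
  rewrite !mulnDl; apply: leq_add (one 2 _).
  by rewrite leq_add ?(lift _ _ _ _ w1) ?(lift _ _ _ _ w2).
- move=> x a r e1 IH1 e2 IH2 A /andP[_ /and4P[rR _ /IH1 w1 /IH2 w2]].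
  rewrite !mulnDl; apply: leq_add.
    by apply: leq_add (one 6 _); rewrite ?(lift _ _ _ _ w1).
  rewrite mul0n addn0.
  apply: (@leq_trans ((tm (fun=> 1) e2 + 5) * X ^ (fdep e2).+1)).
    rewrite expnS mulnCA leq_mul ?BX // mulnDl.
    by rewrite leq_add.
  by rewrite mulnDl leq_add // leq_mul2l pow ?orbT // maxr.
Qed.

Lemma btm_poly R A B l X :
  all (fun p => (p.1 \in A) && wf R A p.2) l ->
  {in R, forall r, B r <= X} -> 0 < X ->
  btm B l <= btm (fun=> 1) l * X ^ \max_(p <- l) fdep p.2.
Proof.
move=> + BX X0; elim: l => [|[x e] l IH] /=; first by rewrite big_nil.
have one c j : c <= c * X ^ j by rewrite leq_pmulr // expn_gt0 X0.
case/andP=> /andP[_ /tm_poly we] /IH le; rewrite big_cons /=.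
rewrite !mulnDl !leq_add //.
- apply: leq_trans (we _ _ BX X0) _.
  by rewrite leq_mul2l leq_pexp2l ?orbT // leq_maxl.
- by rewrite (leq_trans le) // leq_mul2l leq_pexp2l ?orbT // leq_maxr.
Qed.

(** * Loops as sums, products, maxima and remainders *)

Lemma iteri_sum n f : iteri n (fun i acc => acc + f i) 0 = \sum_(i < n) f i.
Proof. by elim: n => [|n IH]; rewrite ?big_ord0 // big_ord_recr /= IH. Qed.

Lemma iteri_prod n f : iteri n (fun i acc => f i * acc) 1 = \prod_(i < n) f i.
Proof.
by elim: n => [|n IH]; rewrite ?big_ord0 // big_ord_recr /= IH mulnC.
Qed.

Lemma iteri_max n f : iteri n (fun i acc => maxn acc (f i)) 0 = \max_(i < n) f i.
Proof. by elim: n => [|n IH]; rewrite ?big_ord0 // big_ord_recr /= IH. Qed.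

Lemma sum_ltn n k : \sum_(i < n) (i < k) = minn n k.
Proof. by elim: n => [|n IH]; rewrite ?big_ord0 ?big_ord_recr /= ?IH; lia. Qed.

Lemma iter_sub_mod q z d : z < d.+1 * q ->
  iter d (fun x => if x < q then x else x - q) z = z %% q.
Proof.
elim: d z => [|d IH] z; first by rewrite mul1n => zq; rewrite modn_small.
move=> zd; rewrite iterSr; case: ltnP => zq.
  by apply: IH; apply: leq_trans zq _; rewrite mulSn leq_addr.
rewrite IH; first by rewrite -[in RHS](subnK zq) modnDr.
by rewrite ltn_subLR // addnC -mulSnr.
Qed.

Lemma iteri_const (X : Type) n (f : X -> X) x : iteri n (fun _ => f) x = iter n f x.
Proof. by elim: n => //= n ->. Qed.

(** * Dynamic programming over layers *)

Section Model.
Variables (n T E D : nat) (a : nat -> nat -> nat -> nat).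

(* Layer [i.+1] stands for time [i]; the layers [0] and [T.+1] have empty
   bags. *)
Definition ndeg p v := \sum_(u < n) a p v u.

(** With layers shifted by one, [p < i] says that time [p] is not after layer [i], and [i < p + 2]
    that it is not before. Existence is expressed by a positive sum, the form that a loop
    computes. *)
Definition nbag i v :=
  (0 < \sum_(p < T) (p < i) * ndeg p v) &&
  (0 < \sum_(p < T) (i < p + 2) * ndeg p v).

(** Radix 1 forces the digit 0 outside the bag, so only bag vertices contribute to the number of
    codes. *)
Definition radix i v := if nbag i v then D else 1.

Definition weight i j := \prod_(u < j) radix i u.

(* A code [m < weight i n] is a mixed-radix number with one digit per vertex.
   The digit [c * E + r] records that [c] intervals have been started and that
   the last one lasts for [r] more time steps, the current one included. *)
Definition digit i m v := (m %% weight i v.+1) %/ weight i v.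

Definition remaining i m v := digit i m v %% E.

(** [idle] lets one time step of the last interval pass. In [start], one summand [E] raises the
    count of intervals and [E - 1] is the full remaining duration. *)
Definition idle x := x - x %% E + (x %% E - 1).
Definition start x := x - x %% E + (E + E - 1).

Definition gain (i m : nat) := \sum_(p < T) (p.+1 == i) * \sum_(u < n) \sum_(v < n)
  ((v < u) && (0 < a p u v) && ((0 < remaining i m u) || (0 < remaining i m v))).

(** A vertex leaving the bag is reset by its radix, and one entering it departs from the digit 0. *)
Definition compat i m' m := [forall v : 'I_n, nbag i v ==>
  ((digit i m v == idle (digit i.-1 m' v)) ||
   (digit i m v == start (digit i.-1 m' v)))].

(* One more than the largest gain of a path ending in [m]; 0 if there is none. *)
Fixpoint table (i m : nat) : nat :=
  if i is i'.+1 then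
    \max_(m' < weight i' n)
      (if (0 < table i' m') && compat i m' m then table i' m' + gain i m else 0)
  else 1.

End Model.

Section Weights.
Variables (n T D : nat) (a : nat -> nat -> nat -> nat).
Hypothesis D_gt0 : 0 < D.

Local Notation weight := (weight n T D a).
Local Notation radix := (radix n T D a).
Local Notation digit := (digit n T D a).

Lemma radix_gt0 i v : 0 < radix i v.
Proof. by rewrite /radix; case: ifP. Qed.

Lemma radix_le i v : radix i v <= D.
Proof. by rewrite /radix; case: ifP. Qed.

Lemma weightS i v : weight i v.+1 = weight i v * radix i v.
Proof. exact: big_ord_recr. Qed.

Lemma weight_gt0 i v : 0 < weight i v.
Proof. by apply: prodn_gt0 => u; apply: radix_gt0. Qed.

Lemma weight_dvd i v w : v <= w -> weight i v %| weight i w.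
Proof.
elim: w => [|w IH]; first by rewrite leqn0 => /eqP->.
rewrite leq_eqVlt => /predU1P[->//|/IH vw].
by rewrite weightS dvdn_mulr.
Qed.

Lemma digit_lt i c v : digit i c v < radix i v.
Proof.
by rewrite ltn_divLR ?weight_gt0 // mulnC -weightS ltn_mod weight_gt0.
Qed.

Lemma digit_ltD i c v : digit i c v < D.
Proof. exact: leq_trans (digit_lt _ _ _) (radix_le _ _). Qed.

End Weights.

Arguments radix_gt0 {n T D a}.
Arguments radix_le {n T D a}.
Arguments weightS {n T D a}.
Arguments weight_gt0 {n T D a}.
Arguments weight_dvd {n T D a}.
Arguments digit_lt {n T D a}.
Arguments digit_ltD {n T D a}.

(* Registers below 20 are global variables, those from [tmp] on are temporaries,
   and the others are bound by [Let] and [Fold].  Each expression below takes its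
   arguments from fixed registers, which its evaluation lemma reads off. *)
Local Notation rn := 1.
Local Notation rT := 2.
Local Notation rE := 3.
Local Notation rD := 4.
Local Notation rNN := 5.
Local Notation rt := 6.
Local Notation rI := 7.
Local Notation rM := 8.
Local Notation rN := 9.
Local Notation rNp := 10.
Local Notation rcur := 11.
Local Notation rprev := 12.
Local Notation rTT := 13.
Local Notation raddr := 14.
Local Notation rval := 15.
Local Notation rK := 16.

(** * Evaluating the recurrence *)

(** Repeated addition, looping up to a permitted loop register [r] that bounds the value of [x], as
    [x] itself may not be permitted. *)
Definition EMul r x y :=
  Fold 23 24 r (Num 0)
    (If (Var 23) (Var x) (EAdd (Var 24) (Var y)) (Var 24)).

Definition adjE :=
  ELoad (EAdd (Num 5) (EAdd (EMul rT 20 rNN) (EAdd (EMul rn 21 rn) (Var 22)))).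

Definition degE := Fold 22 25 rn (Num 0) (EAdd (Var 25) adjE).

Definition bagE :=
  If (Num 0) (Fold 20 27 rT (Num 0)
    (If (Var 20) (Var 26) (EAdd (Var 27) degE) (Var 27)))
   (If (Num 0) (Fold 20 27 rT (Num 0)
     (If (Var 26) (EAdd (Var 20) (Num 2)) (EAdd (Var 27) degE) (Var 27)))
    (Num 1) (Num 0)) (Num 0).

Definition weightE :=
  Fold 21 29 rn (Num 1)
    (If (Var 21) (Var 28)
       (If (Num 0) bagE (EMul rD rD 29) (Var 29)) (Var 29)).

Definition modE :=
  Fold 32 33 rD (Var 30)
    (If (Var 33) (Var 31) (Var 33) (ESub (Var 33) (Var 31))).

(** Reducing a huge code modulo a small weight directly would take too many subtractions. It is
    reduced modulo the weights of [n - 1], [n - 2], ... in turn, down to the position just above the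
    wanted digit. Consecutive weights differ by a factor of at most [D], so [rD] subtractions
    suffice each time. *)
Definition modwE :=
  Fold 36 37 rn (Var 34)
    (Let 28 (ESub (ESub (Var rn) (Num 1)) (Var 36))
      (If (Var 35) (Var 28) (Let 31 weightE (Let 30 (Var 37) modE)) (Var 37))).

Definition digitE :=
  Let 38 modwE (Let 28 (Var 35) (Let 31 weightE
    (Fold 39 40 rD (Num 0)
      (If (Var 38) (EAdd (EMul rD 39 31) (Var 31))
        (Var 40) (EAdd (Var 40) (Num 1)))))).

Definition remE := Let 30 digitE (Let 31 (Var rE) modE).

Definition coverE :=
  If (Num 0) (Let 20 (Var 45) (Let 21 (Var 43) (Let 22 (Var 44) adjE)))
    (If (Num 0) (Let 35 (Var 43) remE) (Num 1)
      (If (Num 0) (Let 35 (Var 44) remE) (Num 1) (Num 0)))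
    (Num 0).

Definition gainE :=
  Fold 45 42 rT (Num 0)
   (If (Var 45) (Var 26) (If (Var 26) (EAdd (Var 45) (Num 2))
     (EAdd (Var 42)
      (Fold 43 54 rn (Num 0)
        (EAdd (Var 54) (Fold 44 55 rn (Num 0)
         (If (Var 44) (Var 43) (EAdd (Var 55) coverE) (Var 55))))))
     (Var 42)) (Var 42)).

Definition EqE e1 e2 :=
  If e1 e2 (Num 0) (If e2 e1 (Num 0) (Num 1)).

Definition stepE :=
  Let 48 (Let 30 (Var 46) (Let 31 (Var rE) modE))
   (If (Num 0) (EqE (Var 47) (EAdd (ESub (Var 46) (Var 48))
                                (ESub (Var 48) (Num 1))))
     (Num 1)
     (EqE (Var 47) (EAdd (ESub (Var 46) (Var 48))
                     (ESub (EAdd (Var rE) (Var rE)) (Num 1))))).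

Definition violE :=
   If (Num 0) (Let 26 (Var rI) (Let 21 (Var 35) bagE))
     (Let 46 (Let 26 (ESub (Var rI) (Num 1)) (Let 34 (Var 49) digitE))
      (Let 47 (Let 26 (Var rI) (Let 34 (Var rM) digitE))
        (If (Num 0) stepE (Num 0) (Num 1))))
     (Num 0).

Definition badE := Fold 35 50 rn (Num 0) (EAdd (Var 50) violE).

Definition candE :=
  Let 56 (ELoad (EAdd (Var rprev) (Var 49)))
   (If (Num 0) (Var 56) (If badE (Num 1) (EAdd (Var 56) (Var 53)) (Num 0))
     (Num 0)).

Definition valE :=
  Let 53 (Let 26 (Var rI) (Let 34 (Var rM) gainE))
   (Fold 49 51 rNp (Num 0)
     (Let 52 candE (If (Var 51) (Var 52) (Var 52) (Var 51)))).

Definition globals := iota 0 20.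

Lemma ev_Num m c env : ev m (Num c) env = c. Proof. by []. Qed.
Lemma ev_Var m x env : ev m (Var x) env = env x. Proof. by []. Qed.
Lemma ev_EAdd m e1 e2 env :
  ev m (EAdd e1 e2) env = ev m e1 env + ev m e2 env.
Proof. by []. Qed.
Lemma ev_ESub m e1 e2 env :
  ev m (ESub e1 e2) env = ev m e1 env - ev m e2 env.
Proof. by []. Qed.
Lemma ev_ELoad m e env : ev m (ELoad e) env = m (ev m e env).
Proof. by []. Qed.
Lemma ev_If m e1 e2 e3 e4 env : ev m (If e1 e2 e3 e4) env =
  if ev m e1 env < ev m e2 env then ev m e3 env else ev m e4 env.
Proof. by []. Qed.
Lemma ev_Let m x e1 e2 env :
  ev m (Let x e1 e2) env = ev m e2 (upd env x (ev m e1 env)).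
Proof. by []. Qed.
Lemma ev_Fold m x a r e0 e1 env : ev m (Fold x a r e0 e1) env =
  iteri (env r) (fun i acc => ev m e1 (upd (upd env x i) a acc)) (ev m e0 env).
Proof. by []. Qed.

Definition evE :=
  (ev_Num, ev_Var, ev_EAdd, ev_ESub, ev_ELoad, ev_If, ev_Let).

Lemma updE f x y z : upd f x y z = if z == x then y else f z.
Proof. by []. Qed.

Definition cell n (m : nat -> nat) p u v := m (5 + (p * (n * n) + (u * n + v))).

Section Eval.
Variables (n T E D : nat) (m : nat -> nat) (a : nat -> nat -> nat -> nat).
Hypothesis mA : forall p u v, p < T -> u < n -> v < n -> cell n m p u v = a p u v.

Definition consts env := [/\ env rn = n, env rT = T, env rE = E, env rD = D
  & env rNN = n * n].

Lemma ev_mul r x y env : x \notin [:: 23; 24] -> y \notin [:: 23; 24] ->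
  env x <= env r -> ev m (EMul r x y) env = env x * env y.
Proof.
rewrite !inE !negb_or => /andP[x1 x2] /andP[y1 y2] xr /=.
rewrite (@eq_iteri_lt _ _ _ (fun i acc => acc + (i < env x) * env y)).
  rewrite iteri_sum -big_distrl /= sum_ltn; congr (_ * _).
  exact/minn_idPr.
move=> i acc _; rewrite /upd /= (negPf x1) (negPf x2) (negPf y1) (negPf y2).
by case: ltnP; rewrite ?mul1n ?mul0n ?addn0.
Qed.

Lemma ev_adj env : consts env -> env 20 < T -> env 21 < n -> env 22 < n ->
  ev m adjE env = a (env 20) (env 21) (env 22).
Proof.
move=> [En ET _ _ ENN] pT un vn; rewrite /adjE -mA //.
(* Abstracting a subexpression together with its evaluation lemma keeps it from being unfolded; the
   lemmas below do the same. *)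
move: EMul ev_mul => f fE; rewrite !evE.
by rewrite !fE ?En ?ET ?ENN // ltnW.
Qed.

Lemma ev_deg env : consts env -> env 20 < T -> env 21 < n ->
  ev m degE env = ndeg n a (env 20) (env 21).
Proof.
move=> H pT un; have [En _ _ _ _] := H.
rewrite /degE /ndeg.
move: adjE ev_adj => f fE; rewrite ev_Fold En -iteri_sum.
apply: eq_iteri_lt => i acc ltin.
by rewrite !evE fE.
Qed.

Lemma ev_bag env : consts env -> env 21 < n ->
  ev m bagE env = nbag n T a (env 26) (env 21).
Proof.
move=> H un; have [_ ET _ _ _] := H; rewrite /bagE /nbag.
move: degE ev_deg => f fE; rewrite !evE !ev_Fold ET.
rewrite (@eq_iteri_lt _ _ _
  (fun p acc => acc + (p < env 26) * ndeg n a p (env 21))); last first.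
  move=> i acc ltiT; rewrite !evE fE //.
  by rewrite !updE /=; case: ifP; rewrite ?mul1n ?mul0n ?addn0.
rewrite (@eq_iteri_lt _ _ (fun i acc => ev m (If (Var 26) _ _ _) _)
  (fun p acc => acc + (env 26 < p + 2) * ndeg n a p (env 21))); last first.
  move=> i acc ltiT; rewrite !evE fE //.
  by rewrite !updE /=; case: ifP; rewrite ?mul1n ?mul0n ?addn0.
by rewrite !iteri_sum; case: ifP => //= _; case: ifP.
Qed.

Lemma ev_weight env : consts env -> env 28 <= n ->
  ev m weightE env = weight n T D a (env 26) (env 28).
Proof.
move=> H jn; have [En _ _ ED _] := H.
rewrite /weightE.
move: bagE ev_bag EMul ev_mul => f fE g gE; rewrite ev_Fold En /weight.
rewrite (@eq_iteri_lt _ _ _ (fun u acc =>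
   (if u < env 28 then radix n T D a (env 26) u else 1) * acc)).
  rewrite iteri_prod -big_mkcond /=.
  by rewrite (big_ord_widen _ (fun u => radix n T D a (env 26) u) jn).
move=> i acc lti; rewrite !evE fE //.
rewrite gE // /radix !updE /= ED.
by case: ifP; rewrite ?mul1n //; case: nbag; rewrite ?mul1n.
Qed.

Lemma ev_mod env : consts env -> env 30 < D.+1 * env 31 ->
  ev m modE env = env 30 %% env 31.
Proof.
move=> [_ _ _ ED _] lt; rewrite /modE ev_Fold ED -(iter_sub_mod lt) -iteri_const.
exact: eq_iteri_lt.
Qed.

Hypothesis D_gt0 : 0 < D.

Local Notation weight := (weight n T D a).
Local Notation radix := (radix n T D a).
Local Notation digit := (digit n T D a).

Lemma ev_modw env : consts env -> env 35 < n -> env 34 < weight (env 26) n ->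
  ev m modwE env = env 34 %% weight (env 26) (env 35).+1.
Proof.
move=> H vn cw; have [En _ _ _ _] := H.
rewrite /modwE.
move: weightE ev_weight modE ev_mod => w wE md mdE.
rewrite ev_Fold En ev_Var.
set f := fun i acc => _; set i := env 26; set c := env 34; set v := env 35.
(* After [x] rounds the code is reduced modulo the weight of [n - x], but never below that of
   [v.+1], from where on the loop changes nothing. *)
have fE x : x <= n -> iteri x f c = c %% weight i (maxn v.+1 (n - x)).
  elim: x => [|x IH] xn /=.
    by rewrite subn0 (maxn_idPr vn) modn_small.
  rewrite {}IH ?(ltnW xn) // /f !evE.
  have j1 : n - 1 - x <= n by lia.
  have wjE env' : consts env' -> env' 28 = n - 1 - x -> env' 26 = i ->
      ev m w env' = weight i (n - 1 - x).
    by move=> H' e1 e2; rewrite wE ?e1 ?e2.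
  rewrite !updE /= En -/v; case: ltnP => vx; last first.
    by congr (_ %% weight i _); lia.
  rewrite mdE; rewrite // !updE /= wjE ?updE //=.
    have -> : maxn v.+1 (n - x.+1) = n - 1 - x by lia.
    by rewrite modn_dvdm // weight_dvd //; lia.
  have -> : maxn v.+1 (n - x) = (n - 1 - x).+1 by lia.
  (* The value lies below the previous weight, which is at most [D] times the current one, within
     reach of [D] subtractions. *)
  apply: leq_trans (_ : weight i (n - 1 - x).+1 <= _).
    by rewrite ltn_mod weight_gt0.
  rewrite weightS mulnC leq_mul2r; apply/orP; right.
  exact: leqW (radix_le D_gt0 _ _).
by rewrite fE // subnn maxn0.
Qed.

Lemma ev_digit env : consts env -> env 35 < n -> env 34 < weight (env 26) n ->
  ev m digitE env = digit (env 26) (env 34) (env 35).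
Proof.
move=> H vn cw; have [_ _ _ ED _] := H.
rewrite /digitE.
move: weightE ev_weight modwE ev_modw EMul ev_mul => w wE mw mwE g gE.
rewrite !evE ev_Fold !updE [LHS]/= ED mwE // wE // !updE /=; last exact: ltnW.
set c := env 34 %% _; set q := weight _ (env 35).
(* The loop counts the positive multiples of [q] not exceeding [c]. Their number is the quotient, as
   that is below [D]. *)
rewrite (@eq_iteri_lt _ _ _ (fun i acc => acc + (i < c %/ q))).
  rewrite iteri_sum sum_ltn; apply/minn_idPr/ltnW.
  by apply: leq_trans (digit_lt D_gt0 _ _ _) (radix_le D_gt0 _ _).
move=> i acc lti; rewrite gE // !updE /= ?ED; last exact: ltnW.
rewrite -mulSnr ltnNge -leq_divRL ?weight_gt0 //.
by case: (i < _) => /=; rewrite ?addn0.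
Qed.

Hypothesis E_gt0 : 0 < E.

Lemma small_mod x : x < D -> x < D.+1 * E.
Proof. by move=> xD; apply: (leq_trans xD); rewrite mulSn; nia. Qed.

Lemma ev_rem env : consts env -> env 35 < n -> env 34 < weight (env 26) n ->
  ev m remE env = remaining n T E D a (env 26) (env 34) (env 35).
Proof.
move=> H vn cw; have [_ _ EE _ _] := H.
rewrite /remE; move: digitE ev_digit modE ev_mod => d dE md mdE.
by rewrite !evE mdE //; rewrite !updE /= dE // EE // small_mod // digit_ltD.
Qed.

Lemma ev_cover env : consts env -> env 45 < T -> env 43 < n -> env 44 < n ->
  env 34 < weight (env 26) n ->
  ev m coverE env = (0 < a (env 45) (env 43) (env 44)) &&
    ((0 < remaining n T E D a (env 26) (env 34) (env 43)) ||
     (0 < remaining n T E D a (env 26) (env 34) (env 44))).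
Proof.
move=> H pT un vn cw; rewrite /coverE.
move: adjE ev_adj remE ev_rem => ad adE re reE.
rewrite !evE adE //.
rewrite !reE // !updE /=.
by case: (0 < _) => //; case: (0 < _) => //; case: (0 < _).
Qed.

Lemma ev_gain env : consts env -> env 34 < weight (env 26) n ->
  ev m gainE env = gain n T E D a (env 26) (env 34).
Proof.
move=> H cw; have [En ET _ _ _] := H.
rewrite /gainE; move: coverE ev_cover => co coE.
rewrite ev_Fold ET ev_Num /gain.
rewrite -(iteri_sum T (fun p => (p.+1 == env 26) * \sum_(u < n) \sum_(v < n)
  ((v < u) && (0 < a p u v) && ((0 < remaining n T E D a (env 26) (env 34) u)
     || (0 < remaining n T E D a (env 26) (env 34) v))))).
apply: eq_iteri_lt => p acc pT.
rewrite !evE ev_Fold !updE /= En.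
have -> : (p.+1 == env 26) = (p < env 26) && (env 26 < p + 2) by lia.
case: (p < _); rewrite ?mul0n ?addn0 //=; case: (_ < p + 2);
  rewrite ?mul0n ?addn0 ?mul1n //=; congr (_ + _).
rewrite -(iteri_sum n (fun u => \sum_(v < n)
  ((v < u) && (0 < a p u v) && ((0 < remaining n T E D a (env 26) (env 34) u)
     || (0 < remaining n T E D a (env 26) (env 34) v))))).
apply: eq_iteri_lt => u acc1 un; congr (_ + _).
rewrite !updE /= En -(iteri_sum n (fun v => (v < u) && (0 < a p u v) &&
  ((0 < remaining n T E D a (env 26) (env 34) u)
     || (0 < remaining n T E D a (env 26) (env 34) v)))).
apply: eq_iteri_lt => v acc2 vn.
rewrite coE // !updE /=.
by case: (v < u); rewrite ?addn0.
Qed.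

Lemma ev_eq e1 e2 env : ev m (EqE e1 e2) env = (ev m e1 env == ev m e2 env).
Proof. by rewrite /EqE !evE; case: ltngtP. Qed.

Lemma ev_step env : consts env -> env 46 < D ->
  ev m stepE env = (env 47 == idle E (env 46)) || (env 47 == start E (env 46)).
Proof.
move=> H xD; have [_ _ EE _ _] := H.
rewrite /stepE; move: modE ev_mod EqE ev_eq => md mdE eq eqE.
rewrite !evE !eqE !evE mdE; last by rewrite // !updE /= EE small_mod.
  rewrite !updE /= EE /idle /start.
  by case: (env 47 == _) => //; case: (env 47 == _).
by [].
Qed.

Lemma ev_viol env : consts env -> env 35 < n ->
  env 49 < weight (env rI).-1 n -> env rM < weight (env rI) n ->
  ev m violE env = ~~ (nbag n T a (env rI) (env 35) ==>
    ((digit (env rI) (env rM) (env 35)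
        == idle E (digit (env rI).-1 (env 49) (env 35))) ||
     (digit (env rI) (env rM) (env 35)
        == start E (digit (env rI).-1 (env 49) (env 35))))).
Proof.
move=> H vn cw cw'; rewrite /violE.
move: bagE ev_bag digitE ev_digit stepE ev_step => b bE d dE st stE.
rewrite !evE bE //.
have d1 env' : consts env' -> env' 35 = env 35 -> env' 26 = (env rI).-1 ->
   env' 34 = env 49 -> ev m d env' = digit (env rI).-1 (env 49) (env 35).
  by move=> H' e1 e2 e3; rewrite dE ?e1 ?e2 ?e3.
have d2 env' : consts env' -> env' 35 = env 35 -> env' 26 = env rI ->
   env' 34 = env rM -> ev m d env' = digit (env rI) (env rM) (env 35).
  by move=> H' e1 e2 e3; rewrite dE ?e1 ?e2 ?e3.
rewrite d1 ?updE //= ?subn1 //.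
rewrite d2 ?updE //= ?updE //.
rewrite stE ?updE //= ?digit_ltD //.
by case: nbag => //=; case: (_ || _).
Qed.

Lemma ev_bad env : consts env -> env 49 < weight (env rI).-1 n ->
  env rM < weight (env rI) n ->
  (ev m badE env < 1) = compat n T E D a (env rI) (env 49) (env rM).
Proof.
move=> H cw cw'; have [En _ _ _ _] := H.
rewrite /badE; move: violE ev_viol => vi viE.
rewrite ev_Fold En ev_Num.
rewrite (@eq_iteri_lt _ _ _ (fun v acc => acc + ev m vi (upd env 35 v))).
  rewrite iteri_sum ltnS leqn0 sum_nat_eq0; apply: eq_forallb => v /=.
  rewrite viE //; first by rewrite eqb0 negbK !updE.
  by rewrite updE /= ltn_ord.
by move=> v acc vn; rewrite !evE !viE.
Qed.

Lemma ev_cand env : consts env -> env 49 < weight (env rI).-1 n ->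
  env rM < weight (env rI) n ->
  ev m candE env = if (0 < m (env rprev + env 49)) &&
      compat n T E D a (env rI) (env 49) (env rM)
    then m (env rprev + env 49) + env 53 else 0.
Proof.
move=> H cw cw'.
rewrite /candE; move: badE ev_bad => b bE.
by rewrite !evE bE // !updE /=; case: (0 < _).
Qed.

Lemma ev_val env i : consts env -> env rI = i.+1 ->
  env rNp = weight i n -> env rM < weight i.+1 n ->
  (forall c, c < weight i n -> m (env rprev + c) = table n T E D a i c) ->
  ev m valE env = table n T E D a i.+1 (env rM).
Proof.
move=> H Ei EN cw tab; rewrite /valE.
move: gainE ev_gain candE ev_cand => g gE ca caE.
rewrite evE ev_Fold !evE gE; [|done|by rewrite !updE /= Ei].
rewrite !updE /= EN Ei -(iteri_max _ (fun c =>
  if (0 < table n T E D a i c) && compat n T E D a i.+1 c (env rM)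
  then table n T E D a i c + gain n T E D a i.+1 (env rM) else 0)).
apply: eq_iteri_lt => c acc ltc.
by rewrite caE // !updE /= ?Ei // tab //.
Qed.

End Eval.

(** * Paths of codes and the table *)

Section Paths.
Variables (n T E D : nat) (a : nat -> nat -> nat -> nat).
Local Notation nbag := (nbag n T a).

Lemma nbagP i v : reflect
  (exists p q, [/\ p < T, q < T, p < i, i <= q.+1
     & (0 < ndeg n a p v) && (0 < ndeg n a q v)])
  (nbag i v).
Proof.
have P f : reflect (exists2 p, p < T & 0 < f p) (0 < \sum_(p < T) f p).
  rewrite lt0n; apply: (iffP idP).
    rewrite sum_nat_eq0 negb_forall => /existsP[p /=]; rewrite -lt0n => fp.
    by exists p.
  move=> [p pT fp]; rewrite sum_nat_eq0 negb_forall; apply/existsP.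
  by exists (Ordinal pT); rewrite /= -lt0n.
apply: (iffP andP).
  pose f1 p := (p < i) * ndeg n a p v; pose f2 p := (i < p + 2) * ndeg n a p v.
  move=> [/(P f1)[p pT]]; rewrite /f1 muln_gt0 lt0b => /andP[pi dp].
  move=> /(P f2)[q qT]; rewrite /f2 muln_gt0 lt0b => /andP[iq dq].
  by exists p, q; split=> //; [rewrite addn2 in iq|rewrite dp dq].
move=> [p [q [pT qT pi iq /andP[dp dq]]]]; split.
  by apply/(P (fun p => (p < i) * ndeg n a p v)); exists p; rewrite // pi mul1n.
apply/(P (fun p => (i < p + 2) * ndeg n a p v)).
by exists q; rewrite // addn2 !ltnS iq mul1n.
Qed.

Lemma nbag_le i v : nbag i v -> 0 < i <= T.
Proof. by case/nbagP=> p [q [pT qT pi iq _]]; lia. Qed.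

(** A vertex that has left the bag never returns, so resetting its digit forgets no count that is
    still needed. *)
Lemma nbag_convex i j k v : i <= j <= k -> nbag i v -> nbag k v -> nbag j v.
Proof.
move=> /andP[ij jk] /nbagP[p [_ [pT _ pi _ /andP[dp _]]]].
move=> /nbagP[_ [q [_ qT _ kq /andP[_ dq]]]].
by apply/nbagP; exists p, q; split=> //; [lia|lia|rewrite dp dq].
Qed.

Hypothesis D_gt0 : 0 < D.

Local Notation radix := (radix n T D a).
Local Notation weight := (weight n T D a).
Local Notation digit := (digit n T D a).
Local Notation gain := (gain n T E D a).
Local Notation compat := (compat n T E D a).
Local Notation table := (table n T E D a).

(** The path is found by backtracking: a positive maximum is attained at a compatible predecessor
    whose own entry is positive. *)
Lemma table_sound i m : 0 < table i m ->
  exists mu : nat -> nat, [/\ mu i = m, forall j, j < i -> mu j < weight j n,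
    forall j, j < i -> compat j.+1 (mu j) (mu j.+1)
    & table i m = (\sum_(j < i) gain j.+1 (mu j.+1)).+1].
Proof.
elim: i m => [|i IH] m.
  by exists (fun=> m); split=> //; rewrite big_ord0.
rewrite [table _ _]/=.
have [|m' ->] := @eq_bigmax _ (fun m' : 'I_(weight i n) =>
  if (0 < table i m') && compat i.+1 m' m then table i m' + gain i.+1 m else 0);
  first by rewrite card_ord weight_gt0.
case: ifP => // /andP[/IH[mu [mui lt cp ->]] cpi] _.
exists (fun j => if j == i.+1 then m else mu j); split=> /=.
- by rewrite eqxx.
- move=> j; rewrite ltnS => ji; rewrite ltn_eqF //.
  by move: ji; rewrite leq_eqVlt => /predU1P[->|/lt//]; rewrite mui.
- move=> j; rewrite ltnS => ji; rewrite (ltn_eqF (_ : j < i.+1)) // eqSS.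
  move: ji; rewrite leq_eqVlt => /predU1P[->|ji]; first by rewrite eqxx mui.
  by rewrite ltn_eqF // cp.
- rewrite big_ord_recr /= eqxx addSn; congr (_ + _).+1.
  by apply: eq_bigr => j _; rewrite eqSS ltn_eqF.
Qed.

Lemma table_complete mu i : (forall j, j < i -> mu j < weight j n) ->
  (forall j, j < i -> compat j.+1 (mu j) (mu j.+1)) ->
  \sum_(j < i) gain j.+1 (mu j.+1) < table i (mu i).
Proof.
elim: i => [|i IH] lt cp; first by rewrite big_ord0.
have {}IH : \sum_(j < i) gain j.+1 (mu j.+1) < table i (mu i).
  by apply: IH => j ji; [apply: lt|apply: cp]; apply: leqW.
rewrite big_ord_recr /=.
apply: leq_trans (leq_bigmax (Ordinal (lt i (ltnSn i)))) => /=.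
by rewrite (leq_ltn_trans _ IH) //= cp // -addSn leq_add2r.
Qed.

(** The digits below [v] form a number smaller than the weight of [v], and all later terms are
    multiples of that weight, so reduction and division isolate each digit. *)
Lemma code_exists i s : (forall v, v < n -> s v < radix i v) ->
  exists2 c, c < weight i n & forall v, v < n -> digit i c v = s v.
Proof.
move=> sr; pose enc w := \sum_(u < w) s u * weight i u.
have encS w : enc w.+1 = enc w + s w * weight i w by apply: big_ord_recr.
have enc_lt w : w <= n -> enc w < weight i w.
  elim: w => [|w IH] wn; first by rewrite /enc big_ord0 weight_gt0.
  have := IH (ltnW wn); rewrite encS weightS => le.
  have := sr _ wn; nia.
have enc_mod v w : v <= w -> w <= n -> enc w %% weight i v = enc v.
  elim: w => [|w IH]; first by rewrite leqn0 => /eqP-> _; rewrite modn_small ?enc_lt.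
  rewrite leq_eqVlt => /predU1P[->|vw] wn; first by rewrite modn_small ?enc_lt.
  rewrite encS -(divnK (weight_dvd i v w _)) // mulnA.
  by rewrite addnC modnMDl IH // ltnW.
exists (enc n); first exact: enc_lt.
move=> v vn; rewrite /digit enc_mod // encS divnDMl ?weight_gt0 //.
by rewrite divn_small ?enc_lt // ltnW.
Qed.

Definition xgain p (act : nat -> bool) := \sum_(u < n) \sum_(v < n)
  ((v < u) && (0 < a p u v) && (act u || act v)).

(** This replaces codes by a state sequence for each vertex. Layer [T.+1] has an empty bag, so its
    entry 0 is a maximum over all paths. The strict inequality absorbs the extra one in table
    entries. *)
Lemma answerP t : reflect
  (exists x : nat -> nat -> nat,
    [/\ forall i v, i <= T -> v < n -> x i v < radix i v,
        forall i v, i < T -> v < n -> nbag i.+1 v ->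
          (x i.+1 v == idle E (x i v)) || (x i.+1 v == start E (x i v))
      & t <= \sum_(p < T) xgain p (fun v => 0 < x p.+1 v %% E)])
  (t < table T.+1 0).
Proof.
have gainE (i : nat) (c : nat) (x : nat -> nat) :
    (forall v, v < n -> digit i c v = x v) ->
    gain i c = \sum_(p < T) (p.+1 == i) * xgain p (fun v => 0 < x v %% E).
  move=> dx; apply: eq_bigr => p _; congr (_ * _).
  apply: eq_bigr => u _; apply: eq_bigr => v _.
  by rewrite /remaining !dx.
(* Layer [T.+1] stands for no time and gains nothing, so the sum over layers becomes a sum over
   times. *)
have sumE (x : nat -> nat -> nat) : \sum_(j < T.+1) \sum_(p < T) (p.+1 == j.+1) *
       xgain p (fun v => 0 < x j.+1 v %% E) =
     \sum_(p < T) xgain p (fun v => 0 < x p.+1 v %% E).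
  rewrite exchange_big; apply: eq_bigr => p _ /=.
  rewrite (bigD1 (widen_ord (leqnSn _) p)) //= eqxx mul1n big1 ?addn0 // => j.
  by rewrite -val_eqE eqSS eq_sym => /= /negPf->.
apply: (iffP idP).
  move=> tlt; have /table_sound[mu [_ mult mucp tabE]] := leq_trans (ltn0Sn t) tlt.
  exists (fun i v => digit i (mu i) v); split.
  - by move=> i v _ _; apply: digit_lt.
  - move=> i v iT vn b.
    by have /forallP/(_ (Ordinal vn))/implyP/(_ b) := mucp _ (leqW iT).
  - rewrite -(sumE (fun i v => digit i (mu i) v)) -ltnS.
    rewrite (leq_trans tlt) // tabE ltnS; apply: leq_sum => j _.
    by rewrite (@gainE _ _ (fun v => digit j.+1 (mu j.+1) v)).
move=> [x [xr xs tle]].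
have cP i : exists c, (i <= T) ==>
    (c < weight i n) && [forall v : 'I_n, digit i c v == x i v].
  case: (leqP i T) => iT; last by exists 0.
  have [c c1 c2] := @code_exists i (x i) (fun v => xr i v iT).
  by exists c; rewrite c1; apply/forallP => v; rewrite c2.
(* Beyond [T] the code is 0, which at layer [T.+1] is the entry in question. *)
pose mu i := if i <= T then xchoose (cP i) else 0.
have muP i : i <= T ->
    mu i < weight i n /\ forall v, v < n -> digit i (mu i) v = x i v.
  move=> iT; rewrite /mu; move: (xchoose _) (xchooseP (cP i)) => c /=.
  rewrite iT => /andP[lt /forallP dg].
  by split=> // v vn; apply/eqP: (dg (Ordinal vn)).
have muT : mu T.+1 = 0 by rewrite /mu; move: (xchoose _) => c; rewrite ltnn.
rewrite -muT; apply: leq_ltn_trans (@table_complete mu T.+1 _ _); first last.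
- move=> j jT; apply/forallP => v; apply/implyP => b.
  have jT' : j < T by case/andP: (nbag_le b).
  have [_ /(_ v (ltn_ord v)) ->] := muP _ jT'.
  by have [_ /(_ v (ltn_ord v)) -> /=] := muP _ (ltnW jT'); apply: xs.
- by move=> j jT; have [] := muP j jT.
apply: leq_trans tle _; rewrite -sumE; apply: leq_sum => j _.
case: (ltnP j T) => jT; first by rewrite (@gainE _ _ (x j.+1)) //; case: (muP _ jT).
rewrite big1 // => p _; rewrite eqSS ltn_eqF ?mul0n //.
exact: leq_trans (ltn_ord p) jT.
Qed.

End Paths.

(** * State sequences of a single vertex *)

Section Digit.
Variable E : nat.
Hypothesis E_gt1 : 1 < E.

Let idle_decomp x : idle E x = x %/ E * E + (x %% E - 1).
Proof. by rewrite /idle {1}(divn_eq x E) addnK. Qed.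

Let start_decomp x : start E x = (x %/ E).+1 * E + (E - 1).
Proof. by rewrite /start {1}(divn_eq x E) addnK mulSnr; lia. Qed.

Lemma idle_mod x : idle E x %% E = x %% E - 1.
Proof.
by rewrite idle_decomp modnMDl modn_small //; have := ltn_pmod x (ltnW E_gt1); lia.
Qed.

Lemma idle_div x : idle E x %/ E = x %/ E.
Proof.
have lt := ltn_pmod x (ltnW E_gt1).
rewrite idle_decomp divnMDl; last exact: ltnW.
rewrite [(_ - _) %/ _]divn_small ?addn0 //.
exact: leq_ltn_trans (leq_subr _ _) lt.
Qed.

Lemma start_mod x : start E x %% E = E - 1.
Proof. by rewrite start_decomp modnMDl modn_small //; lia. Qed.

Lemma start_div x : start E x %/ E = (x %/ E).+1.
Proof.
rewrite start_decomp divnMDl; last exact: ltnW.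
by rewrite [(_ - _) %/ _]divn_small ?addn0 //; lia. Qed.

Variable bg : nat -> bool.

(** Inside the bag the quotient of the state is at least the number of starts so far, and it never
    exceeds [K]. A positive remainder is traced back along idle steps to the start that set it to
    [E - 1]. *)
Lemma vertex_sound K M (x : nat -> nat) :
  (forall i j k, i <= j <= k -> bg i -> bg k -> bg j) ->
  (forall i, i <= M -> ~~ bg i -> x i = 0) -> (forall i, i <= M -> x i < K.+1 * E) ->
  ~~ bg 0 ->
  (forall i, i < M -> bg i.+1 ->
     (x i.+1 == idle E (x i)) || (x i.+1 == start E (x i))) ->
  let st i := bg i.+1 && (x i.+1 == start E (x i)) in
  \sum_(i < M) st i <= K /\
  (forall i, i <= M -> 0 < x i %% E ->
     exists2 b, b < i & st b && (i - b + x i %% E <= E)).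
Proof.
move=> cvx x0 xlt bg0 xs st.
have idle_neq_start y : (idle E y == start E y) = false.
  by apply/eqP => /(congr1 (divn^~ E)); rewrite idle_div start_div; lia.
have qK i : i <= M -> x i %/ E <= K.
  by move=> iM; rewrite -ltnS ltn_divLR ?xlt // ltnW.
split.
  (* The comparison with the quotient holds only inside the bag; the bound by [K] is carried along
     because it must survive the reset on leaving. *)
  suff /(_ M (leqnn _)) [] : forall i, i <= M -> \sum_(b < i) st b <= K /\
      (bg i -> \sum_(b < i) st b <= x i %/ E) by [].
  elim=> [|i IH] iM; first by rewrite big_ord0.
  have {IH} [IH1 IH2] := IH (ltnW iM); rewrite big_ord_recr /=.
  have [b1|/negPf nb1] := boolP (bg i.+1); last by rewrite /st nb1 addn0; split.
  suff H : \sum_(b < i) st b + st i <= x i.+1 %/ E.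
    by split=> // ; apply: leq_trans H (qK _ iM).
  have le : \sum_(b < i) st b <= x i %/ E.
    (* On entry into the bag no start has occurred yet, by convexity. *)
    have [/IH2//|nb] := boolP (bg i); rewrite big1 // => b _.
    apply/eqP; rewrite eqb0 /st; apply: contra nb => /andP[bb _].
    by apply: cvx bb b1; rewrite ltn_ord leqnSn.
  rewrite /st b1; case/orP: (xs _ iM b1) => /eqP->.
    by rewrite idle_neq_start addn0 idle_div.
  by rewrite eqxx start_div addn1 ltnS.
elim=> [|i IH] iM; first by rewrite (x0 0) // mod0n.
have [b1|nb1] := boolP (bg i.+1); last by rewrite (x0 i.+1) // mod0n.
case/orP: (xs _ iM b1) => /eqP xE.
  rewrite xE idle_mod => r1; have [|b bi /andP[sb le]] := IH (ltnW iM); first lia.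
  by exists b; [lia|rewrite sb; lia].
move=> _; exists i => //; rewrite /st b1 xE eqxx start_mod; lia.
Qed.

Variable A : seq nat.

(** The second disjunct postpones an interval beginning before the vertex enters the bag to the step
    of entry. *)
Definition starts_at i := has (fun b => (b == i) || ((b < i) && ~~ bg i)) A.

Fixpoint history i :=
  if i is i'.+1 then
    if bg i then (if starts_at i' then start E (history i') else idle E (history i'))
    else 0
  else 0.

Lemma history_off i : ~~ bg i -> history i = 0.
Proof. by case: i => //= i /negPf->. Qed.

Lemma history_step i : bg i.+1 ->
  (history i.+1 == idle E (history i)) || (history i.+1 == start E (history i)).
Proof. by move=> /= ->; case: ifP; rewrite eqxx ?orbT. Qed.

(** A start inside the bag is charged to an element of [A] equal to the current time. On entry the
    old quotient is 0, and a single element not after the current time pays for the start. *)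
Lemma history_div_count i : history i %/ E <= count (fun b => b < i) A.
Proof.
elim: i => [|i IH] /=; first by rewrite div0n.
have cS : count (fun b => b < i.+1) A = count (fun b => b < i) A + count_mem i A.
  by elim: A => //= b s ->; lia.
case: (bg i.+1); last by rewrite div0n.
case: ifP => [st|_]; last by rewrite idle_div cS (leq_trans IH) ?leq_addr.
rewrite start_div; have [bi|nbi] := boolP (bg i); last first.
  rewrite history_off // div0n -has_count; apply: sub_has st => b.
  by case/orP=> [/eqP->|/andP[/ltnW]].
have : has (pred1 i) A.
  by apply: sub_has st => b; rewrite bi andbF orbF.
by rewrite has_count cS; lia.
Qed.

(** There is at most one start per step, even if several intervals begin together; this is why
    counts may be capped at [T]. *)
Lemma history_div_le i : history i %/ E <= i.
Proof.
elim: i => [|i IH] /=; first by rewrite div0n.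
case: (bg i.+1); last by rewrite div0n.
by case: ifP; rewrite ?start_div ?idle_div // => _; apply: leqW.
Qed.

(** Since [b], or since the entry into the bag if that is later, each step lowers the remainder by
    at most one, and further starts reset it to its maximum. *)
Lemma history_active i b : b \in A -> b <= i -> bg i.+1 ->
  E - 1 <= history i.+1 %% E + (i - b).
Proof.
move=> bA; elim: i => [|i IH] bi bg1.
  rewrite /= bg1 ifT; first by rewrite start_mod leq_addr.
  by apply/hasP; exists b; rewrite // -leqn0 bi.
rewrite [history _]/= bg1; case: ifPn => [_|/hasPn/(_ b bA)].
  by rewrite start_mod leq_addr.
rewrite negb_or => /andP[nb].
rewrite ltn_neqAle nb bi /= negbK => bgi.
have := IH _ bgi; rewrite -/(history i.+1) idle_mod; lia.
Qed.

End Digit.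

(** * Reading the input *)

Lemma nth_flatten_uniform (X : Type) (x0 : X) (ss : seq (seq X)) r i j :
  all (fun s => size s == r) ss -> i < size ss -> j < r ->
  nth x0 (flatten ss) (i * r + j) = nth x0 (nth [::] ss i) j.
Proof.
elim: ss i => // s ss IH [|i] /= /andP[/eqP sr al] lti ltj.
  by rewrite mul0n nth_cat sr ltj.
by rewrite nth_cat sr mulSn -addnA ltnNge leq_addr /= addKn IH.
Qed.

Section Graph.
Variables (V : finType) (T : nat) (G : tgraph V T) (k l t : nat).

Local Notation n := #|V|.
Local Notation a := (cell n (nth 0 (encode G k l t))).
Local Notation rk := (@enum_rank V).

Lemma cell_encode (p : 'I_T) (u v : V) :
  a p (rk u) (rk v) = ([set u; v] \in edges G p).
Proof.
rewrite /cell /encode nth_cat [size _]/= ltnNge leq_addr [~~ _]/= addKn.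
rewrite nth_flatten_uniform ?size_map.
- rewrite (nth_map p) ?size_enum_ord // nth_ord_enum.
  rewrite (@nth_flatten_uniform _ 0 _ n); last exact: ltn_ord.
  + rewrite (nth_map u) -?cardE ?ltn_ord //.
    by rewrite (nth_map u) -?cardE ?ltn_ord // !nth_enum_rank.
  + by apply/allP => s /mapP[w _ ->]; rewrite size_map -cardE.
  + by rewrite size_map -cardE ltn_ord.
- by apply/allP => s /mapP[w _ ->]; rewrite size_allpairs -cardE.
- by rewrite -enumT size_enum_ord.
- apply: leq_trans (_ : (rk u).+1 * n <= _).
    by rewrite mulSnr ltn_add2l ltn_ord.
  by rewrite leq_mul2r ltn_ord orbT.
Qed.

Lemma ndeg_gt0 (p : 'I_T) v : (0 < ndeg n a p (rk v)) = (1 <= deg G p v).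
Proof.
rewrite /ndeg lt0n sum_nat_eq0 negb_forall.
apply/idP/idP => [/existsP[u /=]|/card_gt0P[e]].
  rewrite -{1}(enum_valK u) cell_encode eqb0 negbK => ed.
  by apply/card_gt0P; exists [set v; enum_val u]; rewrite inE ed !inE eqxx.
rewrite inE => /andP[ed ve].
have /eqP/cards2P[x [y [xy eE]]] := edges_card2 ed.
apply/existsP; move: ve; rewrite eE !inE => /orP[]/eqP ve.
  by exists (rk y); rewrite /= cell_encode ve -eE ed.
by exists (rk x); rewrite /= cell_encode ve setUC -eE ed.
Qed.

Lemma nbag_vim_bag (i : 'I_T) v : nbag n T a i.+1 (rk v) = (v \in vim_bag G i).
Proof.
rewrite inE; apply/nbagP/existsP.
  move=> [p [q [pT qT pi iq /andP[dp dq]]]].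
  exists (Ordinal pT); apply/existsP; exists (Ordinal qT) => /=.
  rewrite -ltnS pi -ltnS iq -!ndeg_gt0 /=.
  by rewrite dp dq.
move=> [p /existsP[q /and4P[pi iq dp dq]]]; exists p, q.
by rewrite !ltn_ord !ltnS !ndeg_gt0 dp dq.
Qed.

(** Only bag vertices contribute a factor [D], and layers that stand for no time have empty bags. *)
Lemma weight_le_vimw D i : 0 < D -> weight n T D a i n <= D ^ vimw G.
Proof.
move=> D0; rewrite /weight /radix -big_mkcond /= prod_nat_const.
apply: leq_pexp2l => //.
have [iT|niT] := boolP (0 < i <= T); last first.
  rewrite eq_card0 // => u; rewrite unfold_in; apply/negP => /nbag_le.
  by rewrite (negPf niT).
case: i iT => // i /= iT; apply: leq_trans (leq_bigmax (Ordinal iT)).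
rewrite -(card_imset (ssrbool.mem (vim_bag G (Ordinal iT))) (@enum_rank_inj V)).
apply: subset_leq_card.
apply/subsetP => u; rewrite unfold_in => bu; rewrite -(enum_valK u).
apply: imset_f; rewrite -nbag_vim_bag /= enum_valK //.
Qed.

(** An edge has two endpoints of different rank, so it corresponds to exactly one pair with
    [v < u]. *)
Lemma card_covered_by (act : 'I_T -> V -> bool) :
  #|[set x in temporal_edges G | [exists v in x.1, act x.2 v]]| =
  \sum_(p < T) \sum_(u < n) \sum_(v < n)
    ((v < u) && (0 < a p u v) && (act p (enum_val u) || act p (enum_val v))).
Proof.
rewrite -sum1_card.
rewrite (partition_big (fun x => x.2) predT) //=; apply: eq_bigr => p _.
pose f (w : 'I_n * 'I_n) : {set V} * 'I_T := ([set enum_val w.1; enum_val w.2], p).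
pose P (w : 'I_n * 'I_n) := (w.2 < w.1) && (0 < a p w.1 w.2)
   && (act p (enum_val w.1) || act p (enum_val w.2)).
have -> : \sum_(u < n) \sum_(v < n) P (u, v) = #|[set w | P w]|.
  rewrite pair_big -sum1dep_card [RHS]big_mkcond /=.
  by apply: eq_bigr => -[u v] _ /=; case: (P _).
have f_inj : {in [set w | P w] &, injective f}.
  move=> [u v] [u' v']; rewrite !inE /P /f /= => /andP[/andP[vu _] _].
  move=> /andP[/andP[vu' _] _] [/setP eqs].
  have inE' w : (w == u) || (w == v) = (w == u') || (w == v').
    by have := eqs (enum_val w); rewrite !inE !(inj_eq enum_val_inj).
  have := inE' u; have := inE' v; have := inE' u'; have := inE' v'.
  rewrite !eqxx ?orbT /= -!val_eqE /= => h1 h2 h3 h4.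
  by congr (_, _); apply: val_inj => /=; lia.
rewrite -(card_in_imset f_inj) sum1dep_card; apply: eq_card => -[e q].
rewrite !inE /=; apply/idP/imsetP.
  case/andP=> /andP[ed /existsP[w /andP[we aw]]] /eqP qp.
  rewrite {q}qp in ed aw *.
  have /eqP/cards2P[x [y [xy eE]]] := edges_card2 ed.
  wlog yx : x y xy eE / rk y < rk x.
    move=> wl; case: (ltngtP (rk y) (rk x)) => [yx|xlty|eqxy].
    - exact: wl yx.
    - by apply: (wl y x); rewrite // 1?eq_sym // setUC.
    - by move: xy; rewrite -(inj_eq (@enum_rank_inj V)) -val_eqE /= eqxy eqxx.
  exists (rk x, rk y); last by rewrite /f /= !enum_rankK eE.
  rewrite inE /P /= yx cell_encode -eE ed !enum_rankK /=.
  by move: we; rewrite eE !inE => /orP[]/eqP <-; rewrite aw ?orbT.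
case=> -[u v]; rewrite inE /P /f /= => /andP[/andP[vu]].
rewrite -{1}(enum_valK u) -{1}(enum_valK v) cell_encode lt0b => ed acts [-> ->].
rewrite ed eqxx andbT /=; apply/existsP.
by case/orP: acts => ac; [exists (enum_val u)|exists (enum_val v)];
  rewrite !inE eqxx ?orbT.
Qed.

(** * Paths of states and timelines *)

(** The remaining duration includes the current step, so it ranges from 0 to [minn l T + 1], which
    makes [minn l T + 2] values. *)
Local Notation K := (minn k T).
Local Notation E := (minn l T + 2).
Local Notation D := (K.+1 * E).

(** Each start at time [b] yields an interval from [b] of length [l], cut off at the last time
    [T.-1]. *)
Lemma timeline_of_path (x : nat -> nat -> nat) :
  (forall i v, i <= T -> v < n -> x i v < radix n T D a i v) ->
  (forall i v, i < T -> v < n -> nbag n T a i.+1 v ->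
     (x i.+1 v == idle E (x i v)) || (x i.+1 v == start E (x i v))) ->
  exists2 S : {set V * 'I_T * 'I_T}, is_timeline k l S &
    forall (i : 'I_T) v, 0 < x i.+1 (rk v) %% E -> active S v i.
Proof.
move=> xr xs; have E1 : 1 < E by lia.
pose st v i := nbag n T a i.+1 (rk v) && (x i.+1 (rk v) == start E (x i (rk v))).
have vP v : \sum_(i < T) st v i <= K /\ (forall i, i <= T -> 0 < x i (rk v) %% E ->
     exists2 b, b < i & st v b && (i - b + x i (rk v) %% E <= E)).
  apply: (@vertex_sound _ E1 (fun i => nbag n T a i (rk v)) K T
    (fun i => x i (rk v))).
  - by move=> i j h ijh; apply: nbag_convex.
  - move=> i iT /negPf nb; have := xr i (rk v) iT (ltn_ord _).
    by rewrite /radix nb ltnS leqn0 => /eqP.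
  - move=> i iT; apply: leq_trans (xr i (rk v) iT (ltn_ord _)) _.
    by apply: radix_le; rewrite muln_gt0 /= ltnW.
  - by apply/negP => /nbag_le.
  - by move=> i iT; apply: xs.
pose S : {set V * 'I_T * 'I_T} :=
  [set y : V * 'I_T * 'I_T | st y.1.1 y.1.2 &&
    (y.2 == minn (y.1.2 + l) T.-1 :> nat)].
exists S.
  apply/andP; split.
    apply/forallP => -[[v b] c]; apply/implyP; rewrite inE /= => /andP[_ /eqP->].
    by have := ltn_ord b; lia.
  apply/forallP => v; apply: leq_trans (geq_minl k T).
  have [le _] := vP v; apply: leq_trans le.
  set S' := [set _ in _ | _].
  (* The end of an interval is determined by its beginning, so the intervals of [v] are counted by
     their starting times. *)
  have inj : {in S' &, injective (fun y : V * 'I_T * 'I_T => y.1.2)}.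
    move=> [[v1 b1] c1] [[v2 b2] c2]; rewrite !inE /=.
    move=> /andP[/andP[_ /eqP c1E] /eqP->].
    move=> /andP[/andP[_ /eqP c2E] /eqP->] bE; rewrite bE in c1E *.
    by congr (_, _); apply: val_inj; rewrite /= c1E c2E.
  rewrite -(card_in_imset inj).
  have -> : \sum_(i < T) st v i = #|[set i : 'I_T | st v i]|.
    rewrite -sum1dep_card [RHS]big_mkcond /=.
    by apply: eq_bigr => i _; case: (st _ _).
  apply: subset_leq_card; apply/subsetP => b /imsetP[[[v1 b1] c1]].
  by rewrite !inE /= => /andP[/andP[sv _] /eqP<-] ->.
move=> i v r0; have [_ /(_ i.+1 (ltn_ord i) r0) [b bi /andP[sb le]]] := vP v.
have iT := ltn_ord i.
have bT : b < T by lia.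
have cT : minn (b + l) T.-1 < T by lia.
apply/existsP; exists (v, Ordinal bT, Ordinal cT).
by rewrite inE /= sb !eqxx /=; lia.
Qed.

(** Each vertex follows the [history] of the starting times of its intervals. *)
Lemma path_of_timeline (S : {set V * 'I_T * 'I_T}) : is_timeline k l S ->
  exists x : nat -> nat -> nat,
  [/\ forall i v, i <= T -> v < n -> x i v < radix n T D a i v,
      forall i v, i < T -> v < n -> nbag n T a i.+1 v ->
       (x i.+1 v == idle E (x i v)) || (x i.+1 v == start E (x i v))
    & forall (i : 'I_T) v, v \in vim_bag G i -> active S v i ->
        0 < x i.+1 (rk v) %% E].
Proof.
case/andP=> /forallP len /forallP cnt; have E1 : 1 < E by lia.
pose A v := [seq nat_of_ord y.1.2 | y <- enum [set y in S | y.1.1 == v]].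
pose h v := history E (fun i => nbag n T a i (rk v)) (A v).
exists (fun i u =>
  if (insub u : option 'I_n) is Some u' then h (enum_val u') i else 0).
have insE u (un : u < n) : insub u = Some (Ordinal un) :> option 'I_n.
  by rewrite insubT.
split.
- move=> i u iT un; rewrite insE /radix; set v := enum_val _.
  have -> : u = rk v by rewrite /v enum_valK.
  case: ifPn => [_|nb]; last by rewrite /h history_off.
  rewrite -ltn_divLR ?(ltnW E1) // ltnS leq_min; apply/andP; split; last first.
    by apply: leq_trans iT; apply: history_div_le.
  apply: leq_trans (history_div_count E1 _ _ _) _.
  apply: leq_trans (count_size _ _) _; rewrite size_map -cardE; exact: cnt.
- move=> i u iT un; rewrite insE; set v := enum_val _.
  have -> : u = rk v by rewrite /v enum_valK.
  exact: (@history_step E (fun i => nbag n T a i (rk v))).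
- move=> i v; rewrite -nbag_vim_bag valK enum_rankK => bg.
  case/existsP=> -[[v' b] c] /andP[yS /andP[/= /eqP v'v /andP[bi ic]]].
  have /implyP/(_ yS) /= /andP[bc cbl] := len (v', b, c).
  have bA : nat_of_ord b \in A v.
    by apply/mapP; exists (v', b, c); rewrite // mem_enum !inE yS v'v /=.
  have := @history_active E E1 (fun i => nbag n T a i (rk v)) (A v) i b bA bi bg.
  (* The difference [i - b] is at most [l] and below [T], hence less than [E - 1], and the remainder
     is positive. *)
  by rewrite -/(h v) => le; have := ltn_ord i; have := ltn_ord c; lia.
Qed.

Lemma tpvc_table :
  timeline_partial_vertex_cover G k l t = (t < table n T E D a T.+1 0).
Proof.
have D0 : 0 < D by rewrite muln_gt0 /= addn2.
have xgainE (S : {set V * 'I_T * 'I_T}) : #|covered G S| =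
   \sum_(p < T) \sum_(u < n) \sum_(v < n) ((v < u) && (0 < a p u v) &&
     (active S (enum_val u) p || active S (enum_val v) p)).
  exact: (card_covered_by (fun p v => active S v p)).
apply/existsP/(answerP n T E a D0 t).
  move=> [S /andP[tl tc]]; have [x [x1 x2 x3]] := path_of_timeline tl.
  exists x; split=> //; apply: leq_trans tc _; rewrite xgainE.
  apply: leq_sum => p _; apply: leq_sum => u _; apply: leq_sum => v _.
  case vu: (v < u) => //=; case auv: (0 < a p u v) => //=.
  have ed : [set enum_val u; enum_val v] \in edges G p.
    by move: auv; rewrite -{1}(enum_valK u) -{1}(enum_valK v) cell_encode lt0b.
  (* Both endpoints of an edge at time [p] are in the bag of [p], so restricting activity to bags
     loses no covered edge. *)
  have bag w : w \in [set enum_val u; enum_val v] -> w \in vim_bag G p.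
    move=> we; rewrite inE; apply/existsP; exists p; apply/existsP; exists p.
    rewrite leqnn andbb /=; apply/card_gt0P.
    by exists [set enum_val u; enum_val v]; rewrite inE ed.
  have := x3 p (enum_val u); have := x3 p (enum_val v).
  rewrite !bag ?inE ?eqxx ?orbT // !enum_valK => h1 h2.
  case au: (active S (enum_val u) p); first by rewrite h2.
  by case av: (active S (enum_val v) p); first by rewrite h1 ?orbT.
move=> [x [x1 x2 tle]]; have [S tl x3] := timeline_of_path x1 x2.
exists S; rewrite tl; apply: leq_trans tle _; rewrite xgainE.
apply: leq_sum => p _; apply: leq_sum => u _; apply: leq_sum => v _.
case: ((v < u) && (0 < a p u v)) => //=.
have := x3 p (enum_val u); have := x3 p (enum_val v).
rewrite !enum_valK => h1 h2.
case: (0 < x p.+1 u %% E) h2 => [->//|_].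
by case: (0 < x p.+1 v %% E) h1 => [->|_]; rewrite ?orbT.
Qed.

End Graph.

(** * The program *)

(** The table is stored right behind the input; its layer 0 is the single entry 1. *)
Definition initB : seq (nat * expr) := [::
  (rn, ELoad (Num 0)); (rT, ELoad (Num 1));
  (rK, Let 20 (ELoad (Num 2)) (If (Var 20) (Var rT) (Var 20) (Var rT)));
  (rE, Let 20 (ELoad (Num 3))
     (EAdd (If (Var 20) (Var rT) (Var 20) (Var rT)) (Num 2)));
  (rD, EAdd (EMul rT rK rE) (Var rE));
  (rNN, EMul rn rn rn);
  (rt, ELoad (Num 4));
  (rcur, EAdd (Num 5) (EMul rT rT rNN));
  (rN, Num 1); (rval, Num 1); (rTT, EAdd (Var rT) (Num 1))].

(** Layers are stored consecutively, each beginning where the previous one ends. *)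
Definition layerB : seq (nat * expr) := [::
  (rI, EAdd (Var rI) (Num 1)); (rprev, Var rcur); (rNp, Var rN);
  (rcur, EAdd (Var rcur) (Var rN));
  (rN, Let 26 (Var rI) (Let 28 (Var rn) weightE)); (rM, Num 0)].

Definition entryB : seq (nat * expr) := [::
  (raddr, EAdd (Var rcur) (Var rM)); (rval, valE);
  (rM, EAdd (Var rM) (Num 1))].

Definition answerB : seq (nat * expr) := [::
  (0, If (Var rt) (ELoad (Var rcur)) (Num 1) (Num 0))].

Definition program :=
  Seq (block initB) (Seq (Write rcur rval) (Seq
    (WhileLt rI rTT (Seq (block layerB)
      (WhileLt rM rN (Seq (block entryB) (Write raddr rval)))))
    (block answerB))).

Definition wfB R := all (fun p => (p.1 \in globals) && wf R globals p.2).

Lemma wf_initB : wfB [:: rn; rT; rD] initB. Proof. by []. Qed.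
Lemma wf_layerB : wfB [:: rn; rT; rD] layerB. Proof. by []. Qed.
Lemma wf_entryB : wfB [:: rn; rT; rD; rNp] entryB. Proof. by []. Qed.
Lemma wf_answerB : wfB [:: rn; rT; rD] answerB. Proof. by []. Qed.

Lemma globals_lt y : y \in globals -> y < tmp.
Proof. by rewrite mem_iota => /andP[_ y20]; apply: ltn_trans y20 _. Qed.

Lemma block_poly l : wfB [:: rn; rT; rD] l -> exists c d, forall B Y,
  {in [:: rn; rT; rD], forall r, B r <= Y} -> 0 < Y -> btm B l <= c * Y ^ d.
Proof.
move=> wl; exists (btm (fun=> 1) l), (\max_(p <- l) fdep p.2) => B Y BY Y0.
exact: btm_poly wl BY Y0.
Qed.

(** Only the outermost loop over the previous codes is bounded by [rNp], and the gain is computed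
    outside it. The cost is thus linear in [W]. *)
Lemma entry_poly : exists c d, forall B Y W,
  {in [:: rn; rT; rD], forall r, B r <= Y} -> B rNp <= W -> 0 < Y -> 0 < W ->
  btm B entryB <= c * Y ^ d * W.
Proof.
pose e1 := Let 26 (Var rI) (Let 34 (Var rM) gainE).
pose e2 := Let 52 candE (If (Var 51) (Var 52) (Var 52) (Var 51)).
have w1 : wf [:: rn; rT; rD] globals e1 by [].
have w2 : wf [:: rn; rT; rD] [:: 49, 51, 53 & globals] e2 by [].
exists (tm (fun=> 1) e1 + tm (fun=> 1) e2 + 30), (fdep e1 + fdep e2).
move=> B Y W BY BW Y0 W0.
have -> : btm B entryB = 5 + 2 + (tm B e1 + (1 + 6 + B rNp * (tm B e2 + 5)) + 2 + 2 +
   (4 + 2 + 1)) by [].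
have := tm_poly w1 BY Y0; have := tm_poly w2 BY Y0.
have p1 : Y ^ fdep e1 <= Y ^ (fdep e1 + fdep e2) by rewrite leq_pexp2l ?leq_addr.
have p2 : Y ^ fdep e2 <= Y ^ (fdep e1 + fdep e2) by rewrite leq_pexp2l ?leq_addl.
have p3 : 0 < Y ^ (fdep e1 + fdep e2) by rewrite expn_gt0 Y0.
move: (tm B e1) (tm B e2) (tm (fun=> 1) e1) (tm (fun=> 1) e2)
  (Y ^ _) (Y ^ _) (Y ^ _) (B rNp) p1 p2 p3 BW.
move=> a b a' b' z x y N yx zx x0 NW lb la.
have la' : a <= a' * x * W.
  by rewrite (leq_trans la) // -mulnA leq_mul2l (leq_trans yx) ?orbT // leq_pmulr.
have lb' : N * b <= b' * x * W.
  by rewrite mulnC leq_mul // (leq_trans lb) // leq_mul2l zx orbT.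
have xW : W <= x * W by rewrite leq_pmull.
nia.
Qed.

(** * Initial register contents *)

Section Init.
Variables (n T k l t : nat) (m : nat -> nat).
Hypotheses (m0 : m 0 = n) (m1 : m 1 = T) (m2 : m 2 = k)
  (m3 : m 3 = l) (m4 : m 4 = t).

Let E := minn l T + 2.
Let D := (minn k T).+1 * E.

Lemma init_env : bev m initB (fun=> 0) =
  upd (upd (upd (upd (upd (upd (upd (upd (upd (upd (upd (fun=> 0)
    rn n) rT T) rK (minn k T)) rE E) rD D) rNN (n * n)) rt t)
    rcur (5 + T * (n * n))) rN 1) rval 1) rTT (T + 1).
Proof.
have step x e v B env : ev m e env = v ->
    bev m ((x, e) :: B) env = bev m B (upd env x v) by move=> <-.
rewrite /initB; move: EMul (@ev_mul m) => mul mulE.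
rewrite (step rn _ n) ?evE //.
rewrite (step rT _ T) ?evE //.
rewrite (step rK _ (minn k T)); last by rewrite !evE m2.
rewrite (step rE _ E); last by rewrite !evE m3.
rewrite (step rD _ D); last first.
  by rewrite !evE mulE ?geq_minr // /D mulSnr.
rewrite (step rNN _ (n * n)); last by rewrite mulE.
rewrite (step rt _ t); last by rewrite !evE.
rewrite (step rcur _ (5 + T * (n * n))); last by rewrite !evE mulE.
by rewrite (step rN _ 1) // (step rval _ 1) // (step rTT _ (T + 1)).
Qed.

Lemma init_bbound B : n <= B rn -> T <= B rT -> D <= B rD ->
  bbound [:: rn; rT; rD] B m initB (fun=> 0).
Proof.
move=> nY TY DY.
have step x e v b env : ev m e env = v -> (x \in [:: rn; rT; rD] -> v <= B x) ->
    bbound [:: rn; rT; rD] B m b (upd env x v) ->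
    bbound [:: rn; rT; rD] B m ((x, e) :: b) env by move=> <-.
rewrite /initB; move: EMul (@ev_mul m) => mul mulE.
apply: (step rn _ n) => //.
apply: (step rT _ T) => //.
apply: (step rK _ (minn k T)) => //; first by rewrite !evE m2.
apply: (step rE _ E) => //; first by rewrite !evE m3.
apply: (step rD _ D) => //; first by rewrite !evE mulE ?geq_minr // /D mulSnr.
Qed.
End Init.

(** * Correctness and step count of the program *)

Section Run.
Variables (V : finType) (T : nat) (G : tgraph V T) (k l t : nat).

Local Notation n := #|V|.
Local Notation m0 := (nth 0 (encode G k l t)).
Local Notation a := (cell n m0).
Local Notation E := (minn l T + 2).
Local Notation D := ((minn k T).+1 * E).
Local Notation weight := (weight n T D a).
Local Notation table := (table n T E D a).
Local Notation S := (5 + T * (n * n)).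

Variables (Y W : nat).
Hypotheses (nY : n <= Y) (TY : T <= Y) (DY : D <= Y).
Hypothesis weightW : forall i, weight i n <= W.

Definition bnd r := if r == rNp then W else Y.

(** All table layers lie at addresses from [S] on, so the input remains readable. *)
Definition invariant s i :=
  [/\ consts n T E D (reg s), reg s rt = t, reg s rTT = T.+1, reg s rI = i
    & [/\ reg s rN = weight i n, S <= reg s rcur
         & forall y, y < S -> mem s y = m0 y]].

Definition outer i s := invariant s i /\
  forall c, c < weight i n -> mem s (reg s rcur + c) = table i c.

(** The previous layer ends exactly where the current one begins, so writing the latter leaves the
    former intact. *)
Definition inner i c s := [/\ invariant s i.+1, reg s rNp = weight i n, reg s rM = c,
  reg s rprev + weight i n = reg s rcur
  & (forall c', c' < weight i n -> mem s (reg s rprev + c') = table i c') /\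
    (forall c', c' < c -> mem s (reg s rcur + c') = table i.+1 c')].

Let D_gt0 : 0 < D.
Proof. by rewrite muln_gt0 /= addn2. Qed.

Lemma cell_input m : (forall y, y < S -> m y = m0 y) ->
  forall p u v, p < T -> u < n -> v < n -> cell n m p u v = a p u v.
Proof.
move=> mm p u v pT un vn; apply: mm; rewrite ltn_add2l.
have : u * n + v < n * n.
  apply: leq_trans (_ : u.+1 * n <= _); first by rewrite mulSnr ltn_add2l.
  by rewrite leq_mul2r un orbT.
move: (n * n) (u * n + v) => nn w wn.
apply: leq_trans (_ : p.+1 * nn <= _); first by rewrite mulSnr ltn_add2l.
by rewrite leq_mul2r pT orbT.
Qed.

Lemma invariant_bnd s i : invariant s i ->
  forall r, r \in [:: rn; rT; rD] -> reg s r <= Y.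
Proof.
by case=> [[r1 r2 _ r4 _] _ _ _ _] r; rewrite !inE => /or3P[]/eqP->;
  rewrite ?r1 ?r2 ?r4.
Qed.

Lemma run_entry i c s : c < weight i.+1 n -> inner i c s ->
  runs (Seq (block entryB) (Write raddr rval)) s
    (fun tau s' => tau <= btm bnd entryB + 1 /\ inner i c.+1 s').
Proof.
move=> cw [inv rNpE rME rpE [mp mc]].
have [cs rtE rTTE rIE [rNE Sc mi]] := inv; apply: runs_seq.
apply: runs_weaken (@block_runs bnd [:: rn; rT; rD; rNp] globals entryB s (reg s) _
   globals_lt _ wf_entryB _ _) _ => //.
- exact/allP.
- move=> r; rewrite !inE /bnd; case: (r =P rNp) => [-> _|_].
    by rewrite rNpE weightW.
  rewrite orbF => rR; apply: (invariant_bnd inv); by rewrite !inE.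
move=> tau s1 [le1 m1 r1]; apply: runs_write.
have valE' :
    ev (mem s) valE (upd (reg s) raddr (reg s rcur + reg s rM)) = table i.+1 c.
  rewrite (@ev_val n T E D (mem s) a (cell_input mi) D_gt0 _ _ i) ?updE //=.
  - by rewrite rME.
  - by rewrite addn2.
  - by rewrite rME.
have keep x : x \in globals -> x \notin [seq p.1 | p <- entryB] ->
    reg s1 x = reg s x.
  by move=> xg xn; rewrite r1 // bev_notin.
have rad : reg s1 raddr = reg s rcur + c.
  by rewrite r1 // [LHS]/(reg s rcur + reg s rM) rME.
have rvl : reg s1 rval = table i.+1 c.
  by rewrite r1 // [LHS]/(ev (mem s) valE
    (upd (reg s) raddr (reg s rcur + reg s rM))).
have rM1 : reg s1 rM = c.+1.
  rewrite (r1 rM isT); transitivity (reg s rM + 1); first by [].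
  by rewrite rME addn1.
rewrite rad rvl; split; first by rewrite leq_add2r.
have memE y : y < reg s rcur + c ->
    upd (mem s1) (reg s rcur + c) (table i.+1 c) y = mem s y.
  by move=> ylt; rewrite updE m1 ltn_eqF.
split=> /=; rewrite ?rM1 ?keep //.
- split; rewrite /= ?keep //.
    by case: cs => *; split; rewrite ?keep.
  split=> // y yS; rewrite -(mi y yS) memE //.
  by rewrite (leq_trans yS) // (leq_trans Sc) // leq_addr.
split=> c' lt.
  rewrite -(mp c' lt) memE // -rpE -addnA ltn_add2l.
  by rewrite (leq_trans lt) // leq_addr.
move: lt; rewrite ltnS leq_eqVlt => /predU1P[->|lt]; first by rewrite updE eqxx.
by rewrite memE ?ltn_add2l //; apply: mc.
Qed.

Lemma run_layer i s : outer i s ->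
  runs (Seq (block layerB) (WhileLt rM rN (Seq (block entryB) (Write raddr rval)))) s
    (fun tau s' => tau <= btm bnd layerB + (W * (btm bnd entryB + 2) + 1)
       /\ outer i.+1 s').
Proof.
move=> [inv mc]; have [cs rtE rTTE rIE [rNE Sc mi]] := inv; apply: runs_seq.
apply: runs_weaken (@block_runs bnd [:: rn; rT; rD] globals layerB s (reg s) _
   globals_lt _ wf_layerB _ _) _ => //.
- exact/allP.
- move=> r rR; rewrite /bnd ifF; first exact: (invariant_bnd inv).
  by move: rR; rewrite !inE => /or3P[]/eqP->.
move=> tau s1 [le1 m1 r1].
have keep x : x \in globals -> x \notin [seq p.1 | p <- layerB] ->
    reg s1 x = reg s x.
  by move=> xg xn; rewrite r1 // bev_notin.
have wE : reg s1 rN = weight i.+1 n.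
  (* The assignments preceding that of [rN] have already advanced [rI], so the weight is that of the
     new layer. *)
  pose env1 := bev (mem s) (take 4 layerB) (reg s).
  pose env2 := upd (upd env1 26 (env1 rI)) 28 (env1 rn).
  rewrite (r1 rN isT); transitivity (ev (mem s) weightE env2); first by [].
  have e28 : env2 28 = n by case: cs.
  have e26 : env2 26 = i.+1 by transitivity (reg s rI + 1); rewrite // rIE addn1.
  by rewrite (@ev_weight n T E D (mem s) a (cell_input mi)) ?e28 ?e26.
have rI1 : reg s1 rI = i.+1.
  rewrite (r1 rI isT); transitivity (reg s rI + 1); first by [].
  by rewrite rIE addn1.
have rp1 : reg s1 rprev = reg s rcur by rewrite r1.
have rNp1 : reg s1 rNp = weight i n by rewrite r1 // [LHS]/(reg s rN).
have rc1 : reg s1 rcur = reg s rcur + weight i n.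
  by rewrite r1 // [LHS]/(reg s rcur + reg s rN) rNE.
have rM1 : reg s1 rM = 0 by rewrite r1.
have inn : inner i 0 s1.
  split=> //; rewrite ?rp1 ?rc1 //.
  - split; [by case: cs => *; split; rewrite keep|by rewrite keep
      |by rewrite keep|by []|].
    split; [by []|by rewrite rc1 (leq_trans Sc) ?leq_addr|by rewrite m1].
  - by rewrite m1.
apply: runs_weaken (@runs_while rM rN _ s1 (weight i.+1 n) (btm bnd entryB + 1)
  (inner i) inn _ _) _.
- move=> c s2 cw inn2; split; last exact: run_entry.
  by case: inn2 => -[_ _ _ _ [-> _ _]] _ ->.
- by move=> s2 [[_ _ _ _ [-> _ _]] _ ->].
move=> tau2 s2 [le2 [inv2 _ _ _ [_ mc2]]]; split; last by split.
rewrite leq_add // (leq_trans le2) // -addnS leq_add2r leq_mul2r.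
by rewrite weightW orbT.
Qed.

Lemma run_program :
  decides_in_time program (encode G k l t) (timeline_partial_vertex_cover G k l t)
    (btm bnd initB + (1 + ((T.+1 *
      (btm bnd layerB + (W * (btm bnd entryB + 2) + 1)).+1 + 1) + btm bnd answerB))).
Proof.
suff [tau [s [ex [le out]]]] : runs program (init_state (encode G k l t))
  (fun tau s =>
    tau <= btm bnd initB + (1 + ((T.+1 *
      (btm bnd layerB + (W * (btm bnd entryB + 2) + 1)).+1 + 1) + btm bnd answerB)) /\
    reg s 0 = timeline_partial_vertex_cover G k l t).
  by exists tau, s.
set s0 := init_state _; apply: runs_seq.
apply: runs_weaken (@block_runs bnd [:: rn; rT; rD] globals initB s0 (reg s0) _
   globals_lt _ wf_initB _ _) _ => //.
- exact/allP.
- exact: (@init_bbound n T k l).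
move=> t1 s1 [le1 m1 r1]; apply/runs_seq/runs_write; apply: runs_seq.
rewrite (@init_env n T k l t) // in r1.
have out0 : outer 0 (set_mem s1 (reg s1 rcur) (reg s1 rval)).
  have w0 : weight 0 n = 1.
    rewrite /weight big1 // => u _; rewrite /radix ifF //.
    by apply/negP => /nbag_le.
  have rc : reg s1 rcur = S by rewrite r1.
  have rv : reg s1 rval = 1 by rewrite r1.
  split.
    split; rewrite /= ?r1 //.
    - by split; rewrite ?r1.
    - by rewrite updE /= addn1.
    - split; rewrite /= ?rc ?rv ?w0 ?r1 // => y yS.
      by rewrite updE ltn_eqF // m1.
  move=> c; rewrite w0 ltnS leqn0 => /eqP-> /=.
  by rewrite addn0 updE eqxx rv.
apply: runs_weaken (@runs_while rI rTT _ _ T.+1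
  (btm bnd layerB + (W * (btm bnd entryB + 2) + 1)) outer out0 _ _) _.
- move=> i s2 iT out2; split; last exact: run_layer.
  by case: out2 => -[_ _ -> -> _] _.
- by move=> s2 [[_ _ -> -> _] _].
move=> t2 s2 [le2 [inv2 mc2]].
have [_ rtE _ _ [rNE _ _]] := inv2.
apply: runs_weaken (@block_runs bnd [:: rn; rT; rD] globals answerB s2 (reg s2) _
   globals_lt _ wf_answerB _ _) _ => //.
- exact/allP.
- move=> r rR; rewrite /bnd ifF; first exact: (invariant_bnd inv2).
  by move: rR; rewrite !inE => /or3P[]/eqP->.
move=> t3 s3 [le3 m3 r3]; split; first by rewrite !leq_add.
rewrite (r3 0 isT) tpvc_table.
transitivity (if reg s2 rt < mem s2 (reg s2 rcur) then 1 else 0); first by [].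
rewrite -[reg s2 rcur]addn0 mc2 ?weight_gt0 // rtE.
by case: ifP.
Qed.

End Run.

Theorem theorem4p1 :
  exists (p : cmd) (C c : nat),
    forall (V : finType) (T : nat) (G : tgraph V T) (k l t : nat),
      0 < #|V| + T -> 1 <= k ->
      decides_in_time p (encode G k l t)
        (timeline_partial_vertex_cover G k l t)
        (C * ((k + 1) * (l + 2)) ^ (2 * vimw G) * (#|V| + T) ^ c).
Proof.
have [c1 [d1 H1]] := block_poly wf_initB.
have [c2 [d2 H2]] := block_poly wf_layerB.
have [c3 [d3 H3]] := block_poly wf_answerB.
have [c4 [d4 H4]] := entry_poly.
pose d := d1 + d2 + d3 + d4; pose c := c1 + c2 + c3 + c4 + 1.
(* The total is at most [10 * c * Y ^ d.+1 * W ^ 2] with [Y = 6 * X ^ 2]; the constant and the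
   exponent come from there. *)
exists program, (10 * c * 6 ^ d.+1), (2 * d.+1) => V T G k l t X_gt0 _.
(* [D] is at most [(X + 1) * (X + 2)], hence at most [2X * 3X], which explains the 6. *)
pose X := #|V| + T; pose Y := 6 * X ^ 2.
pose K := minn k T; pose L := minn l T; pose D := K.+1 * (L + 2).
pose W := D ^ vimw G.
have nX : #|V| <= X by apply: leq_addr.
have TX : T <= X by apply: leq_addl.
have X0 : 0 < X by [].
have XY : X < Y by rewrite /Y; move: X0; clear; rewrite expnS expn1; nia.
have D_gt0 : 0 < D by rewrite /D muln_gt0 addn2.
have DY : D <= Y.
  have KX : K <= X by rewrite (leq_trans (geq_minr _ _)).
  have LX : L <= X by rewrite (leq_trans (geq_minr _ _)).
  apply: leq_trans (_ : (X + X) * (X + (X + X)) <= _).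
    by rewrite /D; apply: leq_mul; lia.
  by rewrite /Y expnS expn1; lia.
have Y0 : 0 < Y by apply: leq_ltn_trans XY.
have W0 : 0 < W by rewrite expn_gt0 D_gt0.
have nY := leq_trans nX (ltnW XY); have TY := leq_trans TX (ltnW XY).
have wW i : weight #|V| T D (cell #|V| (nth 0 (encode G k l t))) i #|V| <= W.
  exact: weight_le_vimw.
have [tau [s [ex le out]]] := run_program nY TY DY wW.
exists tau, s; split=> //; apply: leq_trans le _; rewrite -/W.
have bndY : {in [:: rn; rT; rD], forall r, bnd Y W r <= Y}.
  by move=> r; rewrite !inE => /or3P[]/eqP->.
pose P := c * Y ^ d.
have leP c' d' : c' <= c -> d' <= d -> c' * Y ^ d' <= P.
  by move=> cc dd; rewrite leq_mul // leq_pexp2l.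
have le1 := leq_trans (H1 _ _ bndY Y0) (leP c1 d1 ltac:(lia) ltac:(lia)).
have le2 := leq_trans (H2 _ _ bndY Y0) (leP c2 d2 ltac:(lia) ltac:(lia)).
have le3 := leq_trans (H3 _ _ bndY Y0) (leP c3 d3 ltac:(lia) ltac:(lia)).
have le4 : btm (bnd Y W) entryB <= P * W.
  apply: leq_trans (H4 _ _ _ bndY (leqnn _) Y0 W0) _.
  by rewrite leq_mul2r leP ?orbT //; lia.
have P0 : 0 < P by rewrite muln_gt0 expn_gt0 Y0 /c addn1.
have WW : W * W <= ((k + 1) * (l + 2)) ^ (2 * vimw G).
  rewrite -expnD addnn -mul2n.
  have [->|v0] := posnP (2 * vimw G); first by [].
  by rewrite leq_exp2r // /D -addn1 leq_mul ?leq_add2r ?geq_minl.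
have T1Y : T.+1 <= Y by apply: leq_ltn_trans XY.
(* [P] bounds the polynomial part of each block, [Y] the number of layers, and [W * W] the number of
   pairs of consecutive codes. After expansion the total has ten summands, each at most [Z]. *)
pose Z := P * Y * (W * W).
have bound : btm (bnd Y W) initB + (1 + (T.+1 * (btm (bnd Y W) layerB +
    (W * (btm (bnd Y W) entryB + 2) + 1)).+1 + 1 + btm (bnd Y W) answerB)) <= 10 * Z.
  have WW0 : 0 < W * W by rewrite muln_gt0 W0.
  have PY0 : 0 < P * Y by rewrite muln_gt0 P0.
  have z1 : P * Y <= Z by rewrite leq_pmulr.
  have z2 : P <= Z by rewrite (leq_trans _ z1) // leq_pmulr.
  have z3 : Y <= Z by rewrite (leq_trans _ z1) // leq_pmull.
  have z4 : Y * W <= Z.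
    rewrite (leq_trans (_ : _ <= P * Y * W)) ?leq_mul2l ?leq_pmulr ?orbT //.
    by rewrite -mulnA leq_pmull.
  have z5 : Y * (W * (P * W)) = Z by rewrite /Z; lia.
  have z6 : T.+1 * (btm (bnd Y W) layerB + (W * (btm (bnd Y W) entryB + 2) + 1)).+1
      <= Y * (P + (W * (P * W + 2) + 1)).+1.
    by rewrite leq_mul // ltnS leq_add // leq_add2r leq_mul2l leq_add2r le4 orbT.
  have z7 : Y * (P + (W * (P * W + 2) + 1)).+1 =
      P * Y + Y * (W * (P * W)) + 2 * (Y * W) + 2 * Y by lia.
  rewrite z7 z5 in z6; lia.
apply: leq_trans bound _.
have -> : 10 * Z = (10 * c * 6 ^ d.+1) * (W * W) * X ^ (2 * d.+1).
  have YE : Y ^ d * Y = 6 ^ d.+1 * X ^ (2 * d.+1).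
    by rewrite -expnSr expnMn -expnM.
  rewrite /Z /P -(mulnA c) YE; lia.
by rewrite leq_mul2r leq_mul2l WW !orbT.
Qed.
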